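(* Let $G$ be a compact abelian group with discrete abelian dual group $\Gamma$, and let $E\subseteq\Gamma$. If the Kronecker constant of $E$ satisfies $\kappa(E)<2$, then $E$ is a Sidon set.
   Context: $G$ is a compact (Hausdorff) abelian group and $\Gamma$ is its discrete abelian dual group, i.e. the group of continuous characters $\gamma:G\to\mathbb{T}$, where $\mathbb{T}=\{z\in\mathbb{C}:|z|=1\}$. A subset $E\subseteq\Gamma$ is $\epsilon$-Kronecker if for every function $\phi:E\to\mathbb{T}$ there exists $x\in G$ such that $|\phi(\gamma)-\gamma(x)|<\epsilon$ for all $\gamma\in E$. The Kronecker constant $\kappa(E)$ is the infimum of the constants $\epsilon$ for which $E$ is $\epsilon$-Kronecker. A subset $E\subseteq\Gamma$ is Sidon if for every bounded function $\phi:E\to\mathbb{C}$ there is a (finite, complex, regular Borel) measure $\mu$ on $G$ with $\widehat{\mu}(\gamma)=\phi(\gamma)$ for all $\gamma\in E$. Here $\widehat{\mu}(\gamma)=\int_G\gamma\,d\mu$, normalized so that the point mass $\delta_x$ satisfies $\widehat{\delta_x}(\gamma)=\gamma(x)$. *)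

(* Defs.v *)
From HB Require Import structures.
From mathcomp Require Import all_boot all_order all_algebra.
From mathcomp Require Import complex.
From mathcomp Require Import all_classical all_reals all_analysis.

Set Implicit Arguments.
Unset Strict Implicit.
Unset Printing Implicit Defensive.

Import Order.TTheory GRing.Theory Num.Theory.
Import numFieldNormedType.Exports.

Local Open Scope classical_set_scope.
Local Open Scope ring_scope.
Local Open Scope complex_scope.

(* The topology of C is the one carried by R[i]^o; the norm of R[i] is
   R[i]-valued, so real bounds are injected with _%:C. *)
Record character (R : realType) (G : topologicalZmodType) := Character {
  character_fun :> G -> R[i] ;
  character_continuous : continuous (character_fun : G -> R[i]^o) ;
  characterD : forall x y : G,
    character_fun (x + y) = character_fun x * character_fun y ;
  character_norm : forall x : G, `|character_fun x| = 1 }.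

(* Functions on E are represented by total functions of which only the values
   on E are used. *)
Definition Kronecker (R : realType) (G : topologicalZmodType)
    (E : set (character R G)) (eps : R) : Prop :=
  forall phi : character R G -> R[i],
    (forall gamma, E gamma -> `|phi gamma| = 1) ->
    exists x : G, forall gamma, E gamma -> `|phi gamma - gamma x| < eps%:C.

(* Positivity of eps is automatic unless E is empty; it makes the set
   bounded below in that case too, so that inf is the genuine infimum. *)
Definition Kronecker_constant (R : realType) (G : topologicalZmodType)
    (E : set (character R G)) : R :=
  inf [set eps : R | 0 < eps /\ Kronecker E eps].

Record complex_measure d (T : measurableType d) (R : realType) :=
  ComplexMeasure {
    measure_re : {charge set T -> \bar R} ;
    measure_im : {charge set T -> \bar R} }.

Definition complex_measure_val d (T : measurableType d) (R : realType)
    (mu : complex_measure T R) (A : set T) : R[i] :=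
  fine (measure_re mu A) +i* fine (measure_im mu A).

Coercion complex_measure_val : complex_measure >-> Funclass.

Definition complex_variation d (T : measurableType d) (R : realType)
    (mu : complex_measure T R) (A : set T) : \bar R :=
  ereal_sup [set (\sum_(0 <= n <oo) (complex.Re `|mu (F n)|)%:E)%E | F in
    [set F : (set T)^nat | [/\ forall n, measurable (F n),
       trivIset setT F & \bigcup_n F n = A]]].

Section charge_integral.
Context d (T : measurableType d) (R : realType).

(* The integral does not depend on the Hahn decomposition that is chosen. *)
Definition charge_integral (nu : {charge set T -> \bar R}) (f : T -> R) : R :=
  let: exist P exN := cid (Hahn_decomposition nu) in
  let: exist N PN := cid exN in
  Rintegral (jordan_pos PN) setT f - Rintegral (jordan_neg PN) setT f.

Definition complex_integral (mu : complex_measure T R) (f : T -> R[i]) : R[i] :=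
  let u x := complex.Re (f x) in let v x := complex.Im (f x) in
  (charge_integral (measure_re mu) u - charge_integral (measure_im mu) v) +i*
  (charge_integral (measure_re mu) v + charge_integral (measure_im mu) u).

End charge_integral.

(* g_sigma_algebraType (@open G) is not used because it asks for a pointed type
   and topologicalZmodType does not provide one. *)
Definition Borel (G : topologicalZmodType) : Type := G.

Section Borel.
Variable G : topologicalZmodType.

HB.instance Definition _ := Choice.on (Borel G).
HB.instance Definition _ := isPointed.Build (Borel G) (0 : G).

Let Borel_measurableC (A : set (Borel G)) :
  <<s @open G >> A -> <<s @open G >> (~` A).
Proof. by move=> sA; rewrite -setTD; exact: sigma_algebraCD. Qed.

HB.instance Definition _ := @isMeasurable.Build (sigma_display (@open G))
  (Borel G) <<s @open G >> (@sigma_algebra0 _ setT (@open G))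
  Borel_measurableC (@sigma_algebra_bigcup _ setT (@open G)).

End Borel.

Definition regular_measure (R : realType) (G : topologicalZmodType)
    (mu : complex_measure (Borel G) R) : Prop :=
  forall A : set (Borel G), measurable A ->
    complex_variation mu A =
      ereal_inf [set complex_variation mu U | U in
        [set U : set G | open U /\ A `<=` U]] /\
    complex_variation mu A =
      ereal_sup [set complex_variation mu K | K in
        [set K : set G | compact K /\ K `<=` A]].

Definition Fourier_Stieltjes (R : realType) (G : topologicalZmodType)
    (mu : complex_measure (Borel G) R) (gamma : character R G) : R[i] :=
  complex_integral mu gamma.

Definition Sidon (R : realType) (G : topologicalZmodType)
    (E : set (character R G)) : Prop :=
  forall phi : character R G -> R[i],
    (exists M : R, forall gamma, E gamma -> `|phi gamma| <= M%:C) ->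
    exists mu : complex_measure (Borel G) R,
      regular_measure mu /\
      forall gamma, E gamma -> Fourier_Stieltjes mu gamma = phi gamma.

(* Main.v *)
(* Let E be Kronecker for some eps < 2.  For a finite F in E and theta in T^F pick
   x(theta) in G with |theta_g - g(x(theta))| < eps.  Then g(x(theta)) / theta_g
   stays away from -1, where the Fejer-type kernel u(t) = (|1 - t|^2 / 4)^M is
   concentrated; so u is small at these points compared with its mean, and the
   signed combination over k <> 0, with the Fourier coefficients of u as weights,
   of the correlations of g(x(theta))^k = g(k x(theta)) with theta_g^k is bounded
   away from 0, uniformly in g and F.

   Take two independent samples theta, theta' and distribute
   k x(theta) + k' x(theta') + y with the Riesz product density
   prod_g (1 + 2q Re(c_g conj(g(y) theta_g^k theta'_g^k'))), where theta, theta'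
   range over roots of unity and y over a finite subset of G that annihilates
   (up to a small error) finitely many nontrivial characters.  In the resulting
   transform at g the multi-degree S comes with the square of a Fourier
   coefficient; averaging over y leaves q c_g times a quantity bounded below, and
   by Bessel's inequality the terms of degree >= 2 add up to O(q^2).  For small q
   this interpolates c within a factor 7/8 with bounded total mass,
   and iteration gives discrete measures of bounded mass that interpolate on F up
   to any error.

   An ultrafilter limit of these discrete measures is a finitely additive set
   function, whose regularization is a regular Borel measure with the same
   integrals of continuous functions. *)
From HB Require Import structures.
Require Import Defs.
From mathcomp Require Import all_boot all_order all_algebra.
From mathcomp Require Import complex.
From mathcomp Require Import all_classical all_reals all_analysis.
From mathcomp Require Import measurable_realfun finmap ring lra zify.

Set Implicit Arguments.
Unset Strict Implicit.
Unset Printing Implicit Defensive.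

Import Order.TTheory GRing.Theory Num.Theory.
Import numFieldNormedType.Exports.

Local Open Scope ring_scope.

(** * Finitely supported measures and Riesz products *)

Section Mean.
Variables (C : numClosedFieldType) (H : nmodType).

Definition mean (s : seq H) (f : H -> C) : C :=
  (size s)%:R^-1 * \sum_(y <- s) f y.

(** Means of multiplicative functions multiply under convolution of samples; since they have modulus
    at most 1, convolving can make one mean small without enlarging the others. *)
Lemma mean_convolution (s t : seq H) (f : H -> C) :
  (forall x y, f (x + y) = f x * f y) ->
  mean [seq x + y | x <- s, y <- t] f = mean s f * mean t f.
Proof.
move=> fD; rewrite /mean size_allpairs natrM invfM mulrACA; congr (_ * _).
rewrite big_allpairs_dep mulr_suml; apply: eq_bigr => x _.
by rewrite mulr_sumr; apply: eq_bigr => y _.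
Qed.

Lemma mean_le1 (s : seq H) (f : H -> C) :
  (forall x, `|f x| = 1) -> `|mean s f| <= 1.
Proof.
move=> f1; rewrite /mean normrM ger0_norm ?invr_ge0 ?ler0n//.
have [->|s0] := eqVneq (size s) 0%N; first by rewrite invr0 mul0r ler01.
rewrite mulrC ler_pdivrMr ?ltr0n ?lt0n// mul1r (le_trans (ler_norm_sum _ _ _))//.
by rewrite (eq_bigr (fun=> 1)) ?big_const_seq ?count_predT ?iter_addr_0.
Qed.

(** Parallelogram law: on the unit circle [4 - |1 + z|^2 = |1 - z|^2]. *)
Lemma norm_add1_lt2 (z : C) : `|z| = 1 -> z != 1 -> `|1 + z| < 2.
Proof.
move=> z1 zN1; rewrite -(@ltr_pXn2r _ 2) ?nnegrE//.
have zz : z * z^* = 1 by rewrite -normCK z1 expr1n.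
have : 0 < `|1 - z| ^+ 2 by rewrite exprn_gt0// normr_gt0 subr_eq0 eq_sym.
rewrite !normCK !rmorphB !rmorphD !rmorph1 /=.
move=> h; rewrite -subr_gt0.
have -> : 2 ^+ 2 - (1 + z) * (1 + z^* ) =
    (1 - z) * (1 - z^* ) + 2 * (1 - z * z^* ) by ring.
by rewrite zz subrr mulr0 addr0.
Qed.

Lemma mean_pair_lt1 (f : H -> C) (h : H) :
  (forall x y, f (x + y) = f x * f y) -> (forall x, `|f x| = 1) ->
  f h != 1 -> `|mean [:: 0; h] f| < 1.
Proof.
move=> fD f1 fh; rewrite /mean !big_cons big_nil addr0.
have f00 : f 0 != 0 by rewrite -normr_eq0 f1 oner_neq0.
have -> : f 0 = 1 by apply: (mulfI f00); rewrite -fD addr0 mulr1.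
rewrite normrM ger0_norm ?invr_ge0 ?ler0n// mulrC ltr_pdivrMr ?ltr0n// mul1r.
exact: norm_add1_lt2.
Qed.

(* Replaces the vanishing of the Haar integrals of nontrivial characters. *)
Lemma mean_nontrivial_small (I : finType) (f : I -> H -> C) (k : C) :
  (forall x e : C, 0 <= x < 1 -> 0 < e -> exists n, x ^+ n <= e) ->
  0 < k ->
  (forall i x y, f i (x + y) = f i x * f i y) ->
  (forall i x, `|f i x| = 1) ->
  exists2 s : seq H, size s != 0%N &
    forall i, (exists h, f i h != 1) -> `|mean s (f i)| <= k.
Proof.
move=> arch k0 fD f1.
suff [s s0 sk] : exists2 s : seq H, size s != 0%N &
    forall i, i \in enum I -> (exists h, f i h != 1) -> `|mean s (f i)| <= k.
  by exists s => // i; apply: sk; rewrite mem_enum.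
elim: (enum I) => [|i r [s s0 sk]]; first by exists [:: 0].
have [[h fh]|nh] := pselect (exists h, f i h != 1); last first.
  by exists s => // j; rewrite inE => /predU1P[->//|]; exact: sk.
have lt1 := mean_pair_lt1 (fD i) (f1 i) fh.
have [n nk] := arch _ _ (introT andP (conj (normr_ge0 _) lt1)) k0.
(* Convolving n times with the pair [0, h] multiplies the mean of [f i] by the n-th power of a
   number of modulus less than 1, and the means already treated by factors of modulus at most 1. *)
pose t := iter n (fun t => [seq x + y | x <- [:: 0; h], y <- t]) s.
have tE j : mean t (f j) = mean [:: 0; h] (f j) ^+ n * mean s (f j).
  rewrite /t; elim: n {nk t} => [|n IH]; first by rewrite expr0 mul1r.
  by rewrite iterS mean_convolution// IH exprS mulrA.
exists t.
  rewrite /t; elim: n {nk t tE} => [//|n IH].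
  by rewrite iterS size_allpairs muln_eq0 negb_or IH.
move=> j; rewrite inE => /predU1P[->|jr] hj.
  rewrite tE normrM normrX (le_trans _ nk)// ler_piMr ?exprn_ge0//.
  exact: mean_le1.
rewrite tE normrM normrX (le_trans _ (sk _ jr hj))// ler_piMl ?normr_ge0//.
by rewrite exprn_ile1 ?normr_ge0// mean_le1.
Qed.

End Mean.

(** * Riesz products and their transforms *)

Section Riesz_product.
Variable C : numClosedFieldType.

(* On the unit circle, the power of z with exponent 0, 1 or -1 for j = 0, 1, 2. *)
Definition signed_pow (j : 'I_3) (z : C) : C :=
  if j == 0 :> nat then 1 else if j == 1 :> nat then z else z^*.

Lemma signed_powM j z w : signed_pow j (z * w) = signed_pow j z * signed_pow j w.
Proof. by rewrite /signed_pow; do 2?case: ifP => _; rewrite ?mulr1 ?rmorphM. Qed.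

Lemma signed_pow_norm j z : `|z| = 1 -> `|signed_pow j z| = 1.
Proof. by rewrite /signed_pow; do 2?case: ifP => _; rewrite ?normr1 ?norm_conjC. Qed.

Lemma signed_pow_norm_le1 j z : `|z| <= 1 -> `|signed_pow j z| <= 1.
Proof. by rewrite /signed_pow; do 2?case: ifP => _; rewrite ?normr1 ?norm_conjC. Qed.

(* Integration against a finitely supported complex measure of mass at most r. *)
Definition atomic (G : Type) (r : C) (v : (G -> C) -> C) :=
  exists2 m : seq (C * G), \sum_(p <- m) `|p.1| <= r &
    forall f, v f = \sum_(p <- m) p.1 * f p.2.

Lemma atomic_le (G : Type) r r' (v : (G -> C) -> C) :
  r <= r' -> atomic r v -> atomic r' v.
Proof. by move=> rr' [m mr mv]; exists m => //; exact: le_trans rr'. Qed.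

Lemma atomic_point (G : Type) (x : G) : atomic 1 (fun f => f x).
Proof.
by exists [:: (1, x)] => [|f]; rewrite big_seq1 ?normr1 ?mul1r.
Qed.

Lemma atomic_scale (G : Type) (a r : C) (v : (G -> C) -> C) :
  atomic r v -> atomic (`|a| * r) (fun f => a * v f).
Proof.
move=> [m mr mv]; exists [seq (a * p.1, p.2) | p <- m] => [|f].
  rewrite big_map; under eq_bigr do rewrite normrM.
  by rewrite -mulr_sumr ler_wpM2l.
by rewrite big_map mv mulr_sumr; apply: eq_bigr => p _; rewrite mulrA.
Qed.

Lemma atomic_sum (G I : Type) (s : seq I) (r : I -> C)
    (v : I -> (G -> C) -> C) :
  (forall i, atomic (r i) (v i)) ->
  atomic (\sum_(i <- s) r i) (fun f => \sum_(i <- s) v i f).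
Proof.
move=> rv; elim: s => [|i s [m mr mv]].
  by exists [::] => [|f]; rewrite !big_nil.
have [m' mr' mv'] := rv i.
exists (m' ++ m) => [|f]; rewrite big_cons big_cat ?lerD//=.
by rewrite mv' mv.
Qed.

Variables (G : zmodType) (T K : finType) (g : T -> G -> C).
Hypothesis gD : forall t x y, g t (x + y) = g t x * g t y.
Hypothesis g1 : forall t x, `|g t x| = 1.
Hypothesis g_inj : forall s t, s != t -> exists x, g s x != g t x.
Hypothesis arch :
  forall x e : C, 0 <= x < 1 -> 0 < e -> exists n, x ^+ n <= e.

Implicit Type S : {ffun T -> 'I_3}.

(** On the torus these are the characters with exponents -1, 0, 1, the ones that occur when a Riesz
    product is multiplied out. *)
Definition monomial S (z : T -> C) : C := \prod_s signed_pow (S s) (z s).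

Definition degree0 : {ffun T -> 'I_3} := [ffun=> 0].
Definition degree1 (t : T) : {ffun T -> 'I_3} := [ffun s => (s == t)%:R].

Lemma monomialM S z w :
  monomial S (fun s => z s * w s) = monomial S z * monomial S w.
Proof. by rewrite -big_split; apply: eq_bigr => s _; rewrite signed_powM. Qed.

Lemma monomial_norm S z : (forall s, `|z s| = 1) -> `|monomial S z| = 1.
Proof.
by move=> z1; rewrite normr_prod big1// => s _; rewrite signed_pow_norm.
Qed.

Lemma monomial_degree0 z : monomial degree0 z = 1.
Proof. by rewrite /monomial big1// => s _; rewrite ffunE. Qed.

Lemma monomial_degree1 t z : monomial (degree1 t) z = z t.
Proof.
rewrite /monomial (bigD1 t)//= ffunE eqxx/= [X in _ * X]big1 ?mulr1// => s st.
by rewrite ffunE (negbTE st).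
Qed.

(* The factor nat, acting through powers of 'i, makes the multi-degrees 0 and
   -1 nontrivial, whatever characters occur in g. *)
Definition twist (i : T * {ffun T -> 'I_3}) (y : G * nat) : C :=
  (- 'i) ^+ y.2 * g i.1 y.1 *
  monomial i.2 (fun s => 'i ^+ y.2 * (g s y.1)^*).

Lemma twistD i x y : twist i (x + y) = twist i x * twist i y.
Proof.
rewrite /twist /= gD exprD [RHS]mulrACA -monomialM; congr (_ * _).
  by rewrite mulrACA.
by apply: eq_bigr => s _; rewrite gD exprD rmorphM mulrACA.
Qed.

Lemma twist_norm i x : `|twist i x| = 1.
Proof.
rewrite /twist !normrM g1 normrX normrN normCi expr1n !mul1r monomial_norm// => s.
by rewrite normrM normrX normCi expr1n mul1r norm_conjC.
Qed.

Lemma twist_degree1 t y : twist (t, degree1 t) y = 1.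
Proof.
rewrite /twist monomial_degree1/= mulrACA -exprMn mulNr -expr2 sqrCi opprK expr1n.
by rewrite -normCK g1 expr1n mulr1.
Qed.

Lemma monomial_single S s0 z : (forall s, s != s0 -> S s = 0) ->
  monomial S z = signed_pow (S s0) (z s0).
Proof.
move=> S0; rewrite /monomial (bigD1 s0)//= big1 ?mulr1// => s /S0 ->.
by rewrite /signed_pow.
Qed.

Lemma neg_imaginary_neq1 : - 'i != 1 :> C.
Proof.
apply/eqP => /(congr1 (fun x => x ^+ 2)); rewrite sqrrN sqrCi expr1n => /eqP.
by rewrite eq_sym -addr_eq0 -mulr2n pnatr_eq0.
Qed.

(** In degree 0 the point [(0, 1)] gives [- 'i], and for a single exponent -1 it gives -1. A single
    exponent 1 at [s0 != t] leaves [g t] times the conjugate of [g s0], nontrivial because the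
    characters are distinct. *)
Lemma twist_nontrivial t S : S != degree1 t -> (#|[set s | S s != 0%R]| <= 1)%N ->
  exists y, twist (t, S) y != 1.
Proof.
move=> St; have g0 s : g s 0 = 1.
  have h : g s 0 != 0 by rewrite -normr_eq0 g1 oner_neq0.
  by apply: (mulfI h); rewrite -gD addr0 mulr1.
rewrite leq_eqVlt ltnS leqn0 => /orP[/cards1P[s0 Ss0]|]; last first.
  move=> /eqP/cards0_eq S0; exists (0, 1%N).
  rewrite /twist/= [monomial _ _]big1 => [|s _].
    by rewrite mulr1 g0 mulr1 expr1 neg_imaginary_neq1.
  have /negbT : (s \in [set s | S s != 0]) = false by rewrite S0 inE.
  by rewrite inE negbK => /eqP ->; rewrite /signed_pow.
have S0 s : s != s0 -> S s = 0.
  move=> ss0; have /negbT : (s \in [set s | S s != 0]) = false.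
    by rewrite Ss0 inE (negbTE ss0).
  by rewrite inE negbK => /eqP.
have Ss00 : S s0 != 0 by move: (set11 s0); rewrite -Ss0 inE.
rewrite /twist/=; have [S1|S1] := eqVneq (S s0) 1; last first.
  exists (0, 1%N); rewrite (monomial_single _ S0)/= /signed_pow.
  have /negbTE -> : S s0 != 0%N :> nat by [].
  have /negbTE -> : S s0 != 1%N :> nat by [].
  rewrite !g0 rmorph1 !mulr1 !expr1 conjCi mulNr mulrN opprK -expr2 sqrCi.
  by rewrite eq_sym -addr_eq0 -mulr2n pnatr_eq0.
have ts0 : s0 != t.
  apply: contra St => /eqP ts0; apply/eqP/ffunP => s; rewrite ffunE -ts0.
  by case: eqVneq => [->|/S0].
have [y gy] := g_inj ts0; exists (y, 0%N).
rewrite (monomial_single _ S0)/= S1 /signed_pow/= !expr0 !mul1r.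
apply: contra gy => /eqP /(congr1 (fun x => x * g s0 y)).
by rewrite -mulrA [_^* * _]mulrC -normCK g1 expr1n mulr1 mul1r => ->.
Qed.

Lemma riesz_factor_ge0 (q x : C) : 0 < q -> q <= 2^-1 -> `|x| <= 1 ->
  0 <= 1 + q * x + q * x^*.
Proof.
move=> q0 q2 x1; rewrite -addrA -mulrDr.
have yr : q * (x + x^*) \is Num.real.
  apply: rpredM; first exact: gtr0_real.
  by rewrite CrealE rmorphD/= conjCK addrC.
have : `|q * (x + x^*)| <= 1.
  rewrite normrM gtr0_norm// -(@mulVf _ 2%:R) ?pnatr_eq0//.
  rewrite ler_pM ?normr_ge0 ?(ltW q0)//.
  by rewrite (le_trans (ler_normD _ _))// norm_conjC (natrD _ 1 1) lerD.
by rewrite real_ler_norml// => /andP[+ _]; rewrite -lerBlDl sub0r.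
Qed.

(* In the transform at t the monomial S has as coefficient the square of the sum
   over k below: both factors of the tensor square carry the same frequency, so
   that Bessel's inequality controls all degrees above 1 simultaneously. *)
Lemma riesz_product_interpolation (q : C) (c : T -> C) (w : K -> C) (X : K -> G)
    (z : K -> T -> C) :
  0 < q -> q <= 2^-1 ->
  (forall t, `|c t| <= 1) ->
  (forall k s, `|z k s| = 1) ->
  \sum_k `|w k| <= 1 ->
  (forall S, S != degree0 -> \sum_k `|w k| * monomial S (z k) = 0) ->
  (forall t, \sum_S `|\sum_k w k * g t (X k) * monomial S (z k)| ^+ 2 <= 1) ->
  exists2 v, atomic 1 v & forall t,
    `|v (g t) - q * c t *
       (\sum_k w k * g t (X k) * monomial (degree1 t) (z k)) ^+ 2| <= q ^+ 2.
Proof.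
move=> q0 q2 c1 z1 w1 w0 bessel.
have q1 : q <= 1 by rewrite (le_trans q2)// invf_le1 ?ltr0n// ler1n.
pose Q S : C := \prod_s (if S s == 0 then 1 else q).
have QE S : Q S = q ^+ #|[set s | S s != 0]|.
  rewrite -prodr_const /Q [RHS]big_mkcond; apply: eq_bigr => s _.
  by rewrite inE; case: eqP.
have Q0 S : 0 <= Q S by rewrite QE exprn_ge0// ltW.
have Q1 S : Q S <= 1 by rewrite QE exprn_ile1// ltW.
(* The tolerance [q ^+ 2] matches the bound on [Q S] for degrees with at least two coordinates in
   the support. *)
have [s s0 sk] := mean_nontrivial_small arch (exprn_gt0 2 q0) twistD twist_norm.
pose W (y : G * nat) r := c r * ('i ^+ y.2 * (g r y.1)^*).
have W1 y r : `|W y r| <= 1.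
  by rewrite /W !normrM normrX normCi norm_conjC g1 expr1n !mulr1.
(* The density is given by its expansion; the product form [PsiE] serves to show that it is
   nonnegative. *)
pose Psi y k k' := \sum_S Q S * monomial S (W y) * monomial S (z k)
  * monomial S (z k').
have PsiE y k k' : Psi y k k' = \prod_r
    (1 + q * (W y r * z k r * z k' r) + q * (W y r * z k r * z k' r)^*).
  transitivity (\prod_r \sum_(j : 'I_3)
      (if j == 0 then 1 else q) * signed_pow j (W y r * z k r * z k' r)).
    rewrite bigA_distr_bigA; apply: eq_bigr => S _.
    rewrite /Q /monomial -!big_split; apply: eq_bigr => r _ /=.
    by rewrite !signed_powM !mulrA.
  apply: eq_bigr => r _; rewrite !big_ord_recl big_ord0 addr0 /signed_pow/=.
  by rewrite mulr1 addrA.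
have Psi0 y k k' : 0 <= Psi y k k'.
  rewrite PsiE prodr_ge0// => r _; apply: riesz_factor_ge0 => //.
  by rewrite 2!normrM !z1 !mulr1.
(* Summation over k' kills every nonzero degree by [w0]; only the constant term of the density
   contributes to the mass. *)
have Psi_sum y k : \sum_k' `|w k'| * Psi y k k' <= 1.
  under eq_bigr do rewrite mulr_sumr.
  rewrite exchange_big/= (bigD1 degree0)//= [X in _ + X]big1 => [|S S0]; last first.
    rewrite (eq_bigr (fun k' => Q S * monomial S (W y) * monomial S (z k) *
      (`|w k'| * monomial S (z k')))) => [|k' _]; last by rewrite mulrCA.
    by rewrite -mulr_sumr w0// mulr0.
  rewrite addr0 (le_trans _ w1)// ler_sum// => k' _.
  by rewrite !monomial_degree0 !mulr1 ler_piMr ?Q1.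
(* The points use the component of y in G; its component in [nat] enters through the weights. *)
pose v f := (size s)%:R^-1 * \sum_(y <- s) (- 'i) ^+ y.2 * (\sum_k \sum_k'
  (w k * w k' * Psi y k k') * f (X k + X k' + y.1)) : C.
exists v.
  pose r (y : G * nat) : C := `|(- 'i) ^+ y.2| *
    \sum_k \sum_k' `|w k * w k' * Psi y k k'| * 1.
  have dv : atomic (`|(size s)%:R^-1| * \sum_(y <- s) r y) v.
    apply: atomic_scale; apply: atomic_sum => y.
    apply: atomic_scale; apply: atomic_sum => k.
    apply: atomic_sum => k'; apply: atomic_scale; exact: atomic_point.
  apply: atomic_le dv.
  rewrite ger0_norm ?invr_ge0// mulrC ler_pdivrMr ?ltr0n ?lt0n// mul1r.
  rewrite (_ : _%:R = \sum_(y <- s) 1 :> C); last first.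
    by rewrite big_const_seq count_predT iter_addr_0.
  apply: ler_sum => y _; rewrite /r normrX normrN normCi expr1n mul1r.
  rewrite (le_trans _ w1)//; apply: ler_sum => k _.
  rewrite (eq_bigr (fun k' => `|w k| * (`|w k'| * Psi y k k'))) => [|k' _].
    by rewrite -mulr_sumr ler_piMr.
  by rewrite mulr1 !normrM (ger0_norm (Psi0 _ _ _)) mulrA.
move=> t; set H := fun S => \sum_k w k * g t (X k) * monomial S (z k).
(* For each degree S, averaging over y gives the mean of a twist, and the sums over k and over k'
   both give [H S], hence the square. *)
have vE : v (g t) =
    \sum_S Q S * monomial S c * mean s (twist (t, S)) * H S ^+ 2.
  rewrite /v /mean mulr_sumr.
  under [RHS]eq_bigr do rewrite [_ * (_ * \sum_(y <- s) _)]mulrC -!mulrA mulr_suml mulr_sumr.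
  rewrite exchange_big; apply: eq_bigr => y _ /=.
  rewrite -mulr_sumr; congr (_ * _).
  transitivity ((- 'i) ^+ y.2 * \sum_k \sum_k' \sum_S
      w k * w k' * (Q S * monomial S (W y) * monomial S (z k) * monomial S (z k')) *
      g t (X k + X k' + y.1)).
    congr (_ * _); apply: eq_bigr => k _; apply: eq_bigr => k' _.
    by rewrite mulr_sumr mulr_suml.
  under eq_bigr do rewrite exchange_big/=.
  rewrite exchange_big/= mulr_sumr; apply: eq_bigr => S _.
  rewrite /H expr2 big_distrlr/= !mulr_sumr; apply: eq_bigr => k _.
  rewrite !mulr_sumr; apply: eq_bigr => k' _.
  rewrite /twist/= /W monomialM !gD; ring.
rewrite vE (bigD1 (degree1 t))//=.
have -> : Q (degree1 t) = q.
  rewrite /Q (bigD1 t)//= ffunE eqxx/= big1 ?mulr1// => r rt.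
  by rewrite ffunE (negbTE rt).
have -> : mean s (twist (t, degree1 t)) = 1.
  rewrite /mean (eq_bigr (fun=> 1)) => [|y _]; last exact: twist_degree1.
  by rewrite big_const_seq count_predT iter_addr_0 mulVf// pnatr_eq0.
rewrite monomial_degree1 mulr1 addrAC subrr add0r.
rewrite (le_trans (ler_norm_sum _ _ _))//.
(* Every S other than [degree1 t] contributes at most [q ^+ 2 * |H S| ^+ 2]: either its twist is
   nontrivial with a small mean, or [Q S] is small. *)
have : q ^+ 2 * \sum_S `|H S| ^+ 2 <= q ^+ 2.
  by rewrite ler_piMr ?exprn_ge0 ?(ltW q0)//; exact: bessel.
apply: le_trans; rewrite mulr_sumr [leRHS](bigD1 (degree1 t))//=.
rewrite ler_wpDl ?mulr_ge0 ?exprn_ge0 ?(ltW q0)//.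
apply: ler_sum => S St; rewrite normrM normrX (normrM _ (mean _ _)) (normrM (Q S)).
rewrite ler_wpM2r ?exprn_ge0//.
have mc : `|monomial S c| <= 1.
  by rewrite normr_prod prodr_ile1// => r _; rewrite normr_ge0 signed_pow_norm_le1.
rewrite ger0_norm//; have [Sle1|Sgt1] := leqP #|[set r | S r != 0%R]| 1.
  have := sk (t, S) (twist_nontrivial St Sle1); apply: le_trans.
  by apply: ler_piMl => //; apply: mulr_ile1.
rewrite (le_trans (ler_piMr _ (mean_le1 _ (twist_norm _))))//.
  by rewrite mulr_ge0.
rewrite (le_trans (ler_piMr _ mc))// QE.
by apply: ler_wiXn2l => //; rewrite ltW.
Qed.

End Riesz_product.

(** * Interpolation on finite sets of characters *)

Section Kronecker_step.
Variable C : numClosedFieldType.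

(** Bessel's inequality for the weights [|w k|], for which the [chi i] are orthogonal of squared
    norm [W <= 1]. With B the sum of the squared coefficients, expanding the squared norm of [L - P]
    gives [0 <= ||L||^2 - 2 B + W B], whence [B <= ||L||^2 <= 1]. *)
Lemma weighted_bessel (I K : finType) (w F : K -> C) (chi : I -> K -> C) :
  (forall k, `|F k| <= 1) -> \sum_k `|w k| <= 1 ->
  (forall i k, `|chi i k| = 1) ->
  (forall i j, i != j -> \sum_k `|w k| * (chi i k * (chi j k)^*) = 0) ->
  \sum_i `|\sum_k w k * F k * chi i k| ^+ 2 <= 1.
Proof.
move=> F1 w1 chi1 orth; pose H i := \sum_k w k * F k * chi i k.
rewrite -[leLHS]/(\sum_i `|H i| ^+ 2).
(* The phase of [w k]; division by zero makes it 0 where [w k = 0]. *)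
pose u k : C := w k / `|w k|.
have wE k : w k = `|w k| * u k.
  rewrite /u; have [->|w0] := eqVneq (w k) 0; first by rewrite normr0 mul0r.
  by rewrite mulrCA divff ?mulr1// normr_eq0.
have u1 k : `|u k| <= 1.
  rewrite /u normrM normfV normr_id; have [->|w0] := eqVneq (w k) 0.
    by rewrite normr0 mul0r.
  by rewrite divff// normr_eq0.
pose L k : C := F k * u k; pose P k := \sum_i H i * (chi i k)^*.
have : 0 <= \sum_k `|w k| * `|L k - P k| ^+ 2.
  by apply: sumr_ge0 => k _; rewrite mulr_ge0 ?exprn_ge0.
have -> : \sum_k `|w k| * `|L k - P k| ^+ 2 =
    \sum_k `|w k| * `|L k| ^+ 2 - \sum_k `|w k| * L k * (P k)^*
    - (\sum_k `|w k| * L k * (P k)^*)^* + \sum_k `|w k| * `|P k| ^+ 2.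
  rewrite rmorph_sum -!sumrB -big_split; apply: eq_bigr => k _ /=.
  rewrite !normCK rmorphB !rmorphM/= conjCK (CrealP (normr_real (w k))).
  by ring.
have -> : \sum_k `|w k| * L k * (P k)^* = \sum_i `|H i| ^+ 2.
  under eq_bigr do rewrite /P rmorph_sum mulr_sumr.
  rewrite exchange_big; apply: eq_bigr => i _ /=.
  rewrite normCK {2}/H mulr_suml; apply: eq_bigr => k _.
  by rewrite rmorphM/= conjCK /L [in RHS]wE; ring.
have -> : \sum_k `|w k| * `|P k| ^+ 2 = (\sum_k `|w k|) * \sum_i `|H i| ^+ 2.
  transitivity (\sum_i \sum_j (H i)^* * H j *
      (\sum_k `|w k| * (chi i k * (chi j k)^*))).
    transitivity (\sum_i \sum_k \sum_j (H i)^* * H j *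
      (`|w k| * (chi i k * (chi j k)^*))); last first.
      apply: eq_bigr => i _; rewrite exchange_big; apply: eq_bigr => j _.
      by rewrite -mulr_sumr.
    rewrite [RHS]exchange_big; apply: eq_bigr => k _ /=.
    rewrite normCK [P k * _]mulrC [LHS]mulrC /P rmorph_sum big_distrlr/= mulr_suml.
    apply: eq_bigr => i _; rewrite mulr_suml; apply: eq_bigr => j _.
    by rewrite rmorphM/= conjCK; ring.
  rewrite mulr_sumr; apply: eq_bigr => i _.
  rewrite (bigD1 i)//= [X in _ + X]big1 ?addr0 => [|j ji]; last first.
    by rewrite orth ?mulr0// eq_sym.
  rewrite mulrC normCK [_^* * _]mulrC; congr (_ * _); apply: eq_bigr => k _.
  by rewrite -normCK chi1 expr1n mulr1.
set B := \sum_i `|H i| ^+ 2; set W := \sum_k _ in w1 *.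
have B0 : 0 <= B by apply: sumr_ge0 => i _; rewrite exprn_ge0.
have -> : B^* = B by apply/CrealP; exact: ger0_real.
move=> h; have : \sum_k `|w k| * `|L k| ^+ 2 <= 1.
  rewrite (le_trans _ w1)//; apply: ler_sum => k _.
  by rewrite ler_piMr// exprn_ile1// normrM mulr_ile1.
apply: le_trans; rewrite -subr_ge0 (le_trans h)//.
rewrite -subr_ge0.
suff -> : forall x, x - B - (x - B - B + W * B) = (1 - W) * B.
  by rewrite mulr_ge0// subr_ge0.
by move=> x; ring.
Qed.

(** For distinct exponents among -1, 0, 1, each summand is [z j], its square, or the conjugate of
    one of these. *)
Lemma signed_pow_orth (J : finType) (z : J -> C) (k l : 'I_3) : k != l ->
  \sum_j z j = 0 -> \sum_j z j ^+ 2 = 0 ->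
  \sum_j signed_pow k (z j) * (signed_pow l (z j))^* = 0.
Proof.
move=> kl z0 zz0; have zc0 : \sum_j (z j)^* = 0 by rewrite -rmorph_sum z0 rmorph0.
have zzc0 : \sum_j (z j)^* * (z j)^* = 0.
  under eq_bigr do rewrite -rmorphM -expr2.
  by rewrite -rmorph_sum zz0 rmorph0.
case: k l kl => [[|[|[|//]]] hk] [[|[|[|//]]] hl] //= _;
  rewrite /signed_pow/=; under eq_bigr do rewrite ?rmorph1 ?conjCK ?mulr1 ?mul1r.
all: by rewrite // -?expr2.
Qed.

(* On the unit circle this is w ^ (a - M). *)
Definition mixed_pow (M a : nat) (w : C) : C := w ^+ a * w^* ^+ M.

Lemma mixed_powM M a w z : mixed_pow M a (w * z) = mixed_pow M a w * mixed_pow M a z.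
Proof. by rewrite /mixed_pow rmorphM !exprMn mulrACA. Qed.

Lemma mixed_powC M a w : mixed_pow M a w^* = (mixed_pow M a w)^*.
Proof. by rewrite /mixed_pow rmorphM !rmorphXn. Qed.

Lemma mixed_pow_norm M a w : `|w| = 1 -> `|mixed_pow M a w| = 1.
Proof. by move=> w1; rewrite normrM !normrX norm_conjC w1 !expr1n mulr1. Qed.

(** The Fourier coefficient of order [a - M] of the kernel [(|1 - w|^2 / 4)^M]. *)
Definition fejer_coef (M a : nat) : C :=
  (-1) ^+ (M + a) * 'C(M.*2, a)%:R / 4%:R ^+ M.

Lemma fejer_coef_mid M : fejer_coef M M = 'C(M.*2, M)%:R / 4%:R ^+ M.
Proof. by rewrite /fejer_coef addnn -mul2n mulnC exprM sqrr_sign mul1r. Qed.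

Lemma fejer_coef_sum M : \sum_(a < M.*2.+1) `|fejer_coef M a| = 1.
Proof.
under eq_bigr do rewrite /fejer_coef !normrM normrX normrN1 expr1n mul1r
  normr_nat normfV normrX normr_nat.
rewrite -mulr_suml -natr_sum.
have -> : (\sum_(i < M.*2.+1) 'C(M.*2, i) = 4 ^ M)%N.
  rewrite (_ : 4 = 2 ^ 2)%N// -expnM mul2n -[in RHS](addn1 1) expnDn.
  by apply: eq_bigr => i _; rewrite !exp1n !muln1.
by rewrite natrX divff// expf_neq0// pnatr_eq0.
Qed.

(** On the circle [|1 - w|^2] is [(1 - w)^2] times minus the conjugate of w; the binomial theorem
    with exponent 2M does the rest. *)
Lemma fejer_sum M (w : C) : `|w| = 1 ->
  \sum_(a < M.*2.+1) fejer_coef M a * mixed_pow M a w = (`|1 - w| ^+ 2 / 4%:R) ^+ M.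
Proof.
move=> w1; have ww : w * w^* = 1 by rewrite -normCK w1 expr1n.
have -> : `|1 - w| ^+ 2 = - w^* * (1 - w) ^+ 2.
  rewrite normCK rmorphB rmorph1 -[X in X - w]ww; ring: ww.
rewrite exprMn exprVn exprMn -exprM mul2n exprDn mulr_sumr mulr_suml.
apply: eq_bigr => a _; rewrite expr1n mul1r /fejer_coef /mixed_pow.
rewrite exprD (exprNn w) (exprNn w^*) -mulr_natr; ring.
Qed.

End Kronecker_step.

(** * One interpolation step, with error 7/8 *)

Section Kronecker_interpolation.
Variables (C : numClosedFieldType) (G : zmodType) (T J : finType).
Variable g : T -> G -> C.
Hypothesis gD : forall t x y, g t (x + y) = g t x * g t y.
Hypothesis g1 : forall t x, `|g t x| = 1.
Hypothesis g_inj : forall s t, s != t -> exists x, g s x != g t x.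
Hypothesis arch :
  forall x e : C, 0 <= x < 1 -> 0 < e -> exists n, x ^+ n <= e.
Variables (M : nat) (z : J -> C) (eps : C).
Let b := fejer_coef C M M.
Hypothesis J_gt0 : (0 < #|J|)%N.
Hypothesis z1 : forall j, `|z j| = 1.
Hypothesis z_sum : forall a : 'I_M.*2.+1, a != M :> nat ->
  \sum_j mixed_pow M a (z j) = 0 /\ \sum_j mixed_pow M a (z j) ^+ 2 = 0.
Hypothesis eps_b : (eps ^+ 2 / 4%:R) ^+ M <= b / 2%:R.
Hypothesis kronecker : forall theta : {ffun T -> J},
  exists x, forall t, `|z (theta t) - g t x| <= eps.

(** Powers of [g t x] are values of [g t] at multiples of x, so points of G realise the frequencies
    of the kernel. *)
Lemma char_mixed_pow a t x : g t (x *+ a - x *+ M) = mixed_pow M a (g t x).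
Proof.
have g0 : g t 0 = 1.
  have h : g t 0 != 0 by rewrite -normr_eq0 g1 oner_neq0.
  by apply: (mulfI h); rewrite -gD addr0 mulr1.
have gN y : g t (- y) = (g t y)^*.
  have h : g t y != 0 by rewrite -normr_eq0 g1 oner_neq0.
  by apply: (mulfI h); rewrite -gD subrr g0 -normCK g1 expr1n.
have gX y n : g t (y *+ n) = g t y ^+ n.
  by elim: n => [|n IH]; rewrite ?mulr0n ?expr0// mulrS gD IH exprS.
by rewrite gD gN !gX rmorphXn.
Qed.

(** The Riesz product gives [q * c t * m ^+ 2] up to [q ^+ 2], where [b / 2 <= m <= b]. Scaled by
    [8 / b ^+ 4] with [q = b ^+ 2 / 8], this is [c t * (m / b) ^+ 2] up to 1/8, and
    [1 - (m / b) ^+ 2 <= 3/4]. *)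
Lemma kronecker_interpolation (c : T -> C) : (forall t, `|c t| <= 1) ->
  exists2 v, atomic (8%:R / b ^+ 4) v &
    forall t, `|v (g t) - c t| <= 7%:R / 8%:R.
Proof.
move=> c1.
have b0 : 0 < b.
  rewrite /b fejer_coef_mid divr_gt0 ?exprn_gt0 ?ltr0n// bin_gt0.
  by rewrite -addnn leq_addr.
have b1 : b <= 1.
  rewrite -(ger0_norm (ltW b0)) -(fejer_coef_sum C M).
  have hM : (M < M.*2.+1)%N by rewrite ltnS -addnn leq_addr.
  by rewrite (bigD1 (Ordinal hM))//= lerDl sumr_ge0.
pose N : C := #|{ffun T -> J}|%:R.
have N0 : 0 < N by rewrite ltr0n card_ffun expn_gt0 J_gt0.
have sumN (r : C) : \sum_(theta : {ffun T -> J}) r / N = r.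
  rewrite sumr_const -mulr_natr -mulrA mulVf ?mulr1// gt_eqF//.
have [x xP] := fin_all_exists kronecker.
pose K := ('I_M.*2.+1 * {ffun T -> J})%type.
(* The frequency 0, at [a = M], is removed: its monomials are constant in theta and would break the
   orthogonality. *)
pose beta a : C := if a == M then 0 else fejer_coef C M a.
pose w (k : K) := beta k.1 / N.
pose X (k : K) := x k.2 *+ k.1 - x k.2 *+ M.
pose zz (k : K) s := (mixed_pow M k.1 (z (k.2 s)))^*.
have zz1 k s : `|zz k s| = 1 by rewrite norm_conjC mixed_pow_norm.
have w1 : \sum_k `|w k| <= 1.
  rewrite -(pair_bigA _ (fun a theta => `|w (a, theta)|))/=.
  rewrite -(fejer_coef_sum C M) ler_sum// => a _.
  rewrite /w/=; under eq_bigr do rewrite normrM normfV (gtr0_norm N0).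
  by rewrite sumN /beta; case: ifP => // _; rewrite normr0.
have orth S S' : S != S' ->
    \sum_k `|w k| * (monomial S (zz k) * (monomial S' (zz k))^*) = 0.
  move=> SS'; have [s Ss] : exists s, S s != S' s.
    apply/existsP; apply: contraNT SS'; rewrite negb_exists => /forallP h.
    by apply/eqP/ffunP => s; apply/eqP; have := h s; rewrite negbK.
  rewrite -(pair_bigA _ (fun a theta => `|w (a, theta)| *
    (monomial S (zz (a, theta)) * (monomial S' (zz (a, theta)))^*)))/=.
  apply: big1 => a _; rewrite /w /= /beta.
  have [aM|aM] := eqVneq (nat_of_ord a) M.
    by apply: big1 => theta _; rewrite mul0r normr0 mul0r.
  rewrite -mulr_sumr; apply/eqP; rewrite mulf_eq0; apply/orP; right; apply/eqP.
  pose p j := (mixed_pow M a (z j))^*.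
  (* The coordinates of theta vary independently, so the sum factors over T, and one coordinate with
     distinct exponents makes it vanish. *)
  transitivity (\prod_r \sum_j signed_pow (S r) (p j) * (signed_pow (S' r) (p j))^*).
    rewrite bigA_distr_bigA; apply: eq_bigr => theta _ /=.
    by rewrite /monomial rmorph_prod -big_split.
  rewrite (bigD1 s)//= signed_pow_orth ?mul0r//.
    by rewrite -rmorph_sum (z_sum aM).1 rmorph0.
  by under eq_bigr do rewrite -rmorphXn; rewrite -rmorph_sum (z_sum aM).2 rmorph0.
have w0 S : S != degree0 T -> \sum_k `|w k| * monomial S (zz k) = 0.
  move=> /orth; under eq_bigr do rewrite monomial_degree0 rmorph1 mulr1.
  by [].
have bessel t :
    \sum_S `|\sum_k w k * g t (X k) * monomial S (zz k)| ^+ 2 <= 1.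
  apply: weighted_bessel => //; first by move=> k; rewrite g1.
  by move=> S k; rewrite monomial_norm.
pose q := b ^+ 2 / 8%:R.
have q0 : 0 < q by rewrite divr_gt0 ?exprn_gt0 ?ltr0n.
have q2 : q <= 2^-1.
  rewrite /q ler_pdivrMr ?ltr0n// (_ : 2^-1 * 8%:R = 4%:R); last by field.
  by rewrite (@le_trans _ _ 1) ?exprn_ile1 ?(ltW b0)// ler1n.
have [v v1 vP] := @riesz_product_interpolation C G T _ g gD g1 g_inj arch q c w X zz
  q0 q2 c1 zz1 w1 w0 bessel.
exists (fun f => (8%:R / b ^+ 4) * v f).
  apply: atomic_le (atomic_scale _ v1).
  by rewrite mulr1 ger0_norm// divr_ge0 ?exprn_ge0 ?ler0n ?(ltW b0).
move=> t; have {vP} := vP t; set H := \sum_k _ => vP.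
(* The rotation error at the point chosen for theta: [|1 - y theta| <= eps], where the kernel is at
   most half of its mean b. *)
pose y theta := g t (x theta) * (z (theta t))^*.
have y1 theta : `|y theta| = 1 by rewrite normrM norm_conjC g1 z1 mulr1.
pose u theta := (`|1 - y theta| ^+ 2 / 4%:R) ^+ M.
have u0 theta : 0 <= u theta by rewrite exprn_ge0// divr_ge0 ?exprn_ge0 ?ler0n.
have ub theta : u theta <= b / 2%:R.
  have -> : u theta = (`|z (theta t) - g t (x theta)| ^+ 2 / 4%:R) ^+ M.
    congr ((_ ^+ 2 / _) ^+ M); rewrite -[RHS]mulr1 -[X in _ * X](z1 (theta t)).
    by rewrite -(norm_conjC (z _)) -normrM mulrBl -normCK z1 expr1n.
  apply: le_trans eps_b; apply: lerXn2r; rewrite ?nnegrE.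
  - by rewrite divr_ge0 ?exprn_ge0 ?ler0n.
  - by rewrite divr_ge0 ?exprn_ge0 ?ler0n// (le_trans _ (xP theta t)).
  - rewrite ler_wpM2r ?invr_ge0 ?ler0n// lerXn2r ?nnegrE//.
    by rewrite (le_trans _ (xP theta t)).
pose m := \sum_theta (b - u theta) / N.
(* Without its middle term, which is b, the expansion of the kernel sums to [u theta - b]. *)
have HE : H = - m.
  rewrite /H -(pair_bigA _ (fun a theta => w (a, theta) * g t (X (a, theta)) *
    monomial (degree1 t) (zz (a, theta))))/= exchange_big /m -sumrN.
  apply: eq_bigr => theta _ /=.
  transitivity ((\sum_(a < M.*2.+1) beta a * mixed_pow M a (y theta)) / N).
    rewrite mulr_suml; apply: eq_bigr => a _; rewrite monomial_degree1.
    rewrite char_mixed_pow /zz /w /y mixed_powM mixed_powC/=; ring.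
  rewrite -mulNr opprB; congr (_ / _).
  rewrite -[u theta](fejer_sum M (y1 theta)).
  have hM : (M < M.*2.+1)%N by rewrite ltnS -addnn leq_addr.
  rewrite (bigD1 (Ordinal hM))//= [in RHS](bigD1 (Ordinal hM))//=.
  rewrite /beta eqxx mul0r add0r.
  have -> : mixed_pow M M (y theta) = 1.
    by rewrite /mixed_pow -exprMn -normCK y1 !expr1n.
  rewrite mulr1 [RHS]addrAC subrr add0r; apply: eq_bigr => a.
  by rewrite -val_eqE/= => /negbTE ->.
have mb : m <= b.
  rewrite -[leRHS]sumN ler_sum// => theta _.
  by rewrite ler_wpM2r ?invr_ge0 ?(ltW N0)// lerBlDr lerDl.
have bm : b / 2%:R <= m.
  rewrite -[leLHS]sumN ler_sum// => theta _.
  rewrite ler_wpM2r ?invr_ge0 ?(ltW N0)// lerBrDr -lerBrDl.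
  by rewrite (_ : b - b / 2%:R = b / 2%:R) ?ub//; field.
have m0 : 0 <= m by apply: le_trans bm; rewrite divr_ge0 ?ler0n ?(ltW b0).
have bn0 : b != 0 by rewrite gt_eqF.
rewrite (_ : 8%:R / b ^+ 4 * v (g t) - c t = 8%:R / b ^+ 4 *
  (v (g t) - q * c t * H ^+ 2) - c t * (1 - (m / b) ^+ 2)); last first.
  by rewrite HE sqrrN /q; field.
rewrite (le_trans (ler_normB _ _))//.
rewrite (_ : 7%:R / 8%:R = 8%:R / b ^+ 4 * q ^+ 2 + 3%:R / 4%:R); last first.
  by rewrite /q; field.
apply: lerD.
  rewrite normrM ger0_norm ?divr_ge0 ?exprn_ge0 ?ler0n ?(ltW b0)//.
  by rewrite ler_wpM2l// divr_ge0 ?exprn_ge0 ?ler0n ?(ltW b0).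
rewrite normrM -[leRHS]mul1r ler_pM// ger0_norm; last first.
  rewrite subr_ge0 exprn_ile1//; first by rewrite divr_ge0// ltW.
  by rewrite ler_pdivrMr// mul1r.
rewrite lerBlDr -lerBlDl (_ : 1 - 3%:R / 4%:R = (2^-1) ^+ 2); last by field.
apply: lerXn2r; rewrite ?nnegrE ?invr_ge0 ?ler0n//.
  by rewrite divr_ge0// ltW.
by rewrite ler_pdivlMr// mulrC.
Qed.

End Kronecker_interpolation.

(** * Sample points, choice of the exponent, and iteration *)

Section Finite_interpolation.
Variable C : numClosedFieldType.
Hypothesis arch :
  forall x e : C, 0 <= x < 1 -> 0 < e -> exists n, x ^+ n <= e.

(** Repeated square roots of -1 give z with [z ^+ (2 ^ k) = -1]. Its order divides [2 ^ k.+1], and a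
    smaller power of 2 would force that value to be 1. *)
Lemma pow2_primitive_root k : exists z : C, (2 ^ k.+1).-primitive_root z.
Proof.
have [z zk] : exists z : C, z ^+ (2 ^ k) = - 1.
  elim: k => [|k [z zk]]; first by exists (- 1); rewrite expr1.
  by exists (sqrtC z); rewrite expnS exprM sqrtCK.
exists z; have zN : z ^+ (2 ^ k.+1) = 1 by rewrite expnSr exprM zk sqrrN expr1n.
have [m mz /(dvdn_pfactor _ _ (isT : prime 2))[e ek mE]] :=
  prim_order_exists (expn_gt0 2 k.+1) zN.
move: ek; rewrite leq_eqVlt => /predU1P[<-|ek]; first by rewrite -mE.
have : z ^+ (2 ^ k) = 1.
  by rewrite -(subnK (ek : e <= k)%N) expnD mulnC exprM -mE (prim_expr_order mz) expr1n.
rewrite zk => /eqP; rewrite eq_sym -addr_eq0 -mulr2n.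
by rewrite pnatr_eq0.
Qed.

Lemma sum_expr_eq0 (y : C) N : y != 1 -> y ^+ N = 1 -> \sum_(j < N) y ^+ j = 0.
Proof.
move=> y1 yN; have /eqP := subrX1 y N.
by rewrite yN subrr eq_sym mulf_eq0 subr_eq0 (negbTE y1) => /eqP.
Qed.

(** The points are the N-th roots of unity for a power N of 2 above 4M. Then 2a and 2M are distinct
    modulo N, so neither the power [a - M] of [zeta] nor its square is 1, and both geometric sums
    vanish. *)
Lemma sample_points M : exists N (z : 'I_N -> C), [/\ (0 < N)%N,
  forall j, `|z j| = 1 &
  forall a : 'I_M.*2.+1, a != M :> nat ->
    \sum_j mixed_pow M a (z j) = 0 /\ \sum_j mixed_pow M a (z j) ^+ 2 = 0].
Proof.
have [zeta zeta2] := pow2_primitive_root (M.*2.*2).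
have [N NM zetaP] : exists2 N, (M.*2.*2 < N)%N & N.-primitive_root zeta.
  exists (2 ^ M.*2.*2.+1)%N => //.
  by rewrite (@ltn_trans M.*2.*2.+1)// ltn_expl.
have N0 : (0 < N)%N by exact: leq_ltn_trans NM.
have zeta1 : `|zeta| = 1.
  apply/eqP; rewrite -(@pexpr_eq1 _ _ N)//; first by rewrite -normrX prim_expr_order// normr1.
exists N, (fun j => zeta ^+ j); split => // [j|a aM].
  by rewrite normrX zeta1 expr1n.
pose y := mixed_pow M a zeta.
have mE j : mixed_pow M a (zeta ^+ j) = y ^+ j.
  by rewrite /y /mixed_pow rmorphXn exprMn -!exprM (mulnC j) (mulnC j).
have yN : y ^+ N = 1.
  rewrite -mE prim_expr_order// /mixed_pow rmorph1 !expr1n.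
  by rewrite mulr1.
have yy1 : y ^+ 2 != 1.
  apply/eqP => /(congr1 (fun x => x * zeta ^+ M.*2)).
  rewrite /y /mixed_pow exprMn -!exprM !muln2 -mulrA -exprMn [zeta^* * _]mulrC.
  rewrite -normCK zeta1 !expr1n mulr1 mul1r => /eqP.
  have small x : (x <= M.*2)%N -> (x.*2 < N)%N.
    by move=> xM; rewrite (leq_ltn_trans _ NM)// leq_double.
  have aM2 := small a (ltn_ord a).
  have MM2 : (M.*2 < N)%N by rewrite small// -addnn leq_addr.
  rewrite (eq_prim_root_expr zetaP) !modn_small//.
  by move=> /eqP/double_inj/eqP; rewrite (negbTE aM).
have y1 : y != 1 by apply: contraNneq yy1 => ->; rewrite expr1n.
split; first by under eq_bigr do rewrite mE; exact: sum_expr_eq0.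
under eq_bigr do rewrite mE -exprM mulnC exprM.
by apply: sum_expr_eq0 => //; rewrite -exprM mulnC exprM yN expr1n.
Qed.

(** The mean of the kernel is thus at least [1 / (2M + 2)], whereas its values within eps of 1 decay
    geometrically in M. *)
Lemma central_binomial_ge M : (4 ^ M <= M.*2.+2 * 'C(M.*2, M))%N.
Proof.
elim: M => [//|M IH].
have h1 : (M.+1 * 'C(M.*2.+2, M.+1) = M.*2.+2 * 'C(M.*2.+1, M))%N.
  exact/esym/(mul_bin_diag M.*2.+2).
have h2 : (M.+1 * 'C(M.*2.+1, M) = M.*2.+1 * 'C(M.*2, M))%N.
  have /esym := mul_bin_down M.*2.+1 M.
  by rewrite subSn -addnn ?leq_addr// addnK.
rewrite doubleS expnS.
have AB : 'C(M.*2.+2, M.+1) = (2 * 'C(M.*2.+1, M))%N.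
  by apply/eqP; rewrite -(@eqn_pmul2l M.+1)// h1 -doubleS -mul2n -mulnA mulnCA.
rewrite AB; suff h : (4 ^ M <= M.+2 * 'C(M.*2.+1, M))%N.
  by rewrite -!doubleS -muln2 -mulnA (mulnA 2 2) mulnCA leq_mul2l h orbT.
rewrite -(@leq_pmul2l M.+1)// mulnCA h2 mulnA.
rewrite (leq_trans (leq_mul (leqnn M.+1) IH))// mulnA leq_mul2r.
by apply/orP; right; lia.
Qed.

Lemma fejer_exponent (eps : C) : 0 <= eps < 2%:R ->
  exists M, (eps ^+ 2 / 4%:R) ^+ M <= fejer_coef C M M / 2%:R.
Proof.
move=> /andP[e0 e2]; pose s := eps / 2%:R.
have s0 : 0 <= s by rewrite divr_ge0.
have [n sn] : exists n, s ^+ n <= 4%:R^-1.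
  by apply: arch; rewrite ?invr_gt0 ?ltr0n// s0 ltr_pdivrMr ?mul1r ?ltr0n.
(* This M satisfies [M + 1 = (n + 1)^2], so [2 (2M + 2) = 4 (n + 1)^2 <= 4^(n + 1)], while
   [s ^+ n <= 1/4] bounds [s ^+ (2M)] by [4^(-2 (n + 2))]. *)
exists (n * n.+2)%N; set M := (n * _)%N.
rewrite (_ : _ / _ = s ^+ 2); last by rewrite /s; field.
rewrite -exprM mulnC exprM -/s fejer_coef_mid.
have h1 : s ^+ M <= 4%:R^-1 ^+ n.+2.
  by rewrite /M exprM lerXn2r ?nnegrE ?exprn_ge0 ?invr_ge0 ?ler0n.
rewrite (@le_trans _ _ ((4%:R^-1 ^+ n.+2) ^+ 2))//.
  by rewrite lerXn2r ?nnegrE ?exprn_ge0 ?invr_ge0 ?ler0n.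
rewrite -exprM exprVn -natrX ler_pdivlMr ?ltr0n//.
rewrite ler_pdivlMr ?exprn_gt0 ?ltr0n// -natrX -mulrA mulrC -natrM.
rewrite ler_pdivrMr ?ltr0n ?expn_gt0// -natrM ler_nat.
rewrite (leq_trans (leq_mul (leqnn 2) (central_binomial_ge M)))//.
rewrite mulnCA mulnA mulnC leq_mul2l; apply/orP; right.
have -> : (M.*2.+2 * 2 = 4 * (n.+1 ^ 2))%N by rewrite /M; lia.
rewrite (@leq_trans (4 * (2 ^ n) ^ 2)%N)//.
  by rewrite leq_pmul2l// leq_exp2r// ltn_expl.
by rewrite -expnM (mulnC n) expnM -[(2 ^ 2)%N]/4%N -expnS leq_exp2l//; lia.
Qed.

(** The residual divided by [r ^+ n] is again bounded by 1, so [step] applies to it; the masses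
    [K * r ^+ n] add up to at most [8 K], since [1 - r = 1/8]. *)
Lemma iterate_interpolation (G : zmodType) (T : finType) (g : T -> G -> C) (K : C) :
  (forall c : T -> C, (forall t, `|c t| <= 1) -> exists2 v, atomic K v &
    forall t, `|v (g t) - c t| <= 7%:R / 8%:R) ->
  forall n (c : T -> C), (forall t, `|c t| <= 1) -> exists2 v, atomic (8%:R * K) v &
    forall t, `|v (g t) - c t| <= (7%:R / 8%:R) ^+ n.
Proof.
move=> step; set r : C := 7%:R / 8%:R.
have r0 : 0 < r by rewrite divr_gt0 ?ltr0n.
have K0 : 0 <= K.
  have [|v [m mK _] _] := step (fun=> 0); first by move=> t; rewrite normr0 ler01.
  by apply: le_trans mK; apply: sumr_ge0.
move=> n c c1; suff [v vK vP] : exists2 v, atomic (8%:R * K * (1 - r ^+ n)) v &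
    forall t, `|v (g t) - c t| <= r ^+ n.
  exists v => //; apply: atomic_le vK; rewrite ler_piMr ?mulr_ge0//.
  by rewrite lerBlDr lerDl exprn_ge0// ltW.
elim: n => [|n [v [m mK mv] vP]].
  exists (fun=> 0) => [|t]; last by rewrite sub0r normrN expr0.
  by exists [::] => [|f]; rewrite big_nil// expr0 subrr mulr0.
have rn0 : 0 < r ^+ n by rewrite exprn_gt0.
have [|v' v'K v'P] := step (fun t => (c t - v (g t)) / r ^+ n).
  move=> t; rewrite normrM normfV (gtr0_norm rn0) ler_pdivrMr// mul1r.
  by rewrite distrC vP.
have [m' m'K m'v] := atomic_scale (r ^+ n) v'K.
exists (fun f => v f + r ^+ n * v' f) => [|t].
  exists (m ++ m') => [|f]; last by rewrite big_cat/= mv m'v.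
  rewrite big_cat/=; apply: le_trans (lerD mK m'K) _.
  rewrite (gtr0_norm rn0) exprS le_eqVlt; apply/orP; left; apply/eqP.
  by rewrite /r; field.
rewrite (_ : _ - _ = r ^+ n * (v' (g t) - (c t - v (g t)) / r ^+ n)).
  by rewrite normrM gtr0_norm// exprSr ler_wpM2l// ltW.
by field; rewrite gt_eqF.
Qed.

(** The order of quantifiers matters: K depends on eps alone, not on the group, the finite family or
    n, so masses stay bounded in the limit. *)
Lemma finite_interpolation (eps : C) : 0 <= eps < 2%:R -> exists K : C,
  forall (G : zmodType) (T : finType) (g : T -> G -> C),
    (forall t x y, g t (x + y) = g t x * g t y) ->
    (forall t x, `|g t x| = 1) ->
    (forall s t, s != t -> exists x, g s x != g t x) ->
    (forall theta : T -> C, (forall t, `|theta t| = 1) ->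
      exists x, forall t, `|theta t - g t x| <= eps) ->
  forall n (c : T -> C), (forall t, `|c t| <= 1) -> exists2 v, atomic K v &
    forall t, `|v (g t) - c t| <= (7%:R / 8%:R) ^+ n.
Proof.
move=> /fejer_exponent[M epsM]; have [N [z [N0 z1 zsum]]] := sample_points M.
exists (8%:R * (8%:R / fejer_coef C M M ^+ 4)) => G T g gD g1 ginj kron.
apply: iterate_interpolation => c c1.
apply: (kronecker_interpolation gD g1 ginj arch _ z1 zsum epsM) => //.
  by rewrite card_ord.
by move=> theta; apply: kron => t; exact: z1.
Qed.

End Finite_interpolation.

Local Open Scope classical_set_scope.

(** * Regular Borel measures as limits of finitely supported ones *)

Section Finitely_additive.
Variables (R : realType) (T : ptopologicalType) (p : set T -> R).
Hypothesis compactT : compact [set: T].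
Hypothesis hausdorffT : hausdorff_space T.
Hypothesis p_ge0 : forall A, 0 <= p A.
Hypothesis pU : forall A B, A `&` B = set0 -> p (A `|` B) = p A + p B.

Lemma additive_set0 : p set0 = 0.
Proof.
have := pU (setI0 set0); rewrite setU0 => /eqP.
by rewrite -subr_eq0 opprD addrA subrr sub0r oppr_eq0 => /eqP.
Qed.

Lemma additive_le A B : A `<=` B -> p A <= p B.
Proof.
move=> AB; rewrite -(setDUK AB) pU ?lerDl//.
by rewrite setDE setICA setICr setI0.
Qed.

Lemma additive_subU A B : p (A `|` B) <= p A + p B.
Proof.
have -> : A `|` B = A `|` (B `\` A).
  apply/seteqP; split => x; last by move=> [|[]]; [left|right].
  by have [?|?] := pselect (A x); [left|move=> [//|]; right].
rewrite pU; first by rewrite lerD2l additive_le// => x [].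
by rewrite setDE setICA setICr setI0.
Qed.

(* p is only finitely additive; its values on closed sets are regularized, first
   on open sets and then on arbitrary sets. *)
Definition inner_value (U : set T) : \bar R :=
  ereal_sup [set (p K)%:E | K in [set K | closed K /\ K `<=` U]].

Definition outer_value (A : set T) : \bar R :=
  ereal_inf [set inner_value U | U in [set U | open U /\ A `<=` U]].

Lemma inner_value_ge K U : closed K -> K `<=` U -> ((p K)%:E <= inner_value U)%E.
Proof. by move=> cK KU; apply: ereal_sup_ubound; exists K. Qed.

Lemma inner_value_le U : (inner_value U <= (p U)%:E)%E.
Proof.
apply: ge_ereal_sup => _ [K [cK KU] <-].
by rewrite lee_fin additive_le.
Qed.

Lemma inner_value_ge0 U : (0 <= inner_value U)%E.
Proof.
rewrite -[0%E]/(0%R%:E) -additive_set0 inner_value_ge//; exact: closed0.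
Qed.

Lemma le_inner_value U V : U `<=` V -> (inner_value U <= inner_value V)%E.
Proof.
move=> UV; apply: ge_ereal_sup => _ [K [cK KU] <-].
by rewrite inner_value_ge//; exact: subset_trans UV.
Qed.

Lemma outer_value_open U : open U -> outer_value U = inner_value U.
Proof.
move=> oU; apply/eqP; rewrite eq_le; apply/andP; split.
  by apply: ereal_inf_lbound; exists U => //; split.
by apply: le_ereal_inf_tmp => _ [V [oV UV] <-]; exact: le_inner_value.
Qed.

Lemma outer_value_ge0 A : (0 <= outer_value A)%E.
Proof. by apply: le_ereal_inf_tmp => _ [U _ <-]; exact: inner_value_ge0. Qed.

Lemma le_outer_value A B : A `<=` B -> (outer_value A <= outer_value B)%E.
Proof.
move=> AB; apply: le_ereal_inf_tmp => _ [U [oU BU] <-].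
by apply: ereal_inf_lbound; exists U => //; split=> //; exact: subset_trans BU.
Qed.

Lemma outer_value_fin A : outer_value A \is a fin_num.
Proof.
rewrite ge0_fin_numE ?outer_value_ge0// (@le_lt_trans _ _ (p setT)%:E) ?ltry//.
rewrite (le_trans (le_outer_value (@subsetT _ A)))//.
by rewrite outer_value_open ?inner_value_le//; exact: openT.
Qed.

Lemma outer_value_set0 : outer_value set0 = 0%E.
Proof.
apply/eqP; rewrite eq_le outer_value_ge0 andbT outer_value_open; last exact: open0.
by rewrite (le_trans (inner_value_le _))// additive_set0.
Qed.

(** By normality, disjoint open sets A and B contain the disjoint closed sets [K \ U] and [K \ V];
    removing each from K gives the two pieces. *)
Lemma closed_cover2 (K U V : set T) : closed K -> open U -> open V -> K `<=` U `|` V ->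
  exists K1 K2, [/\ closed K1, closed K2, K1 `<=` U, K2 `<=` V & K = K1 `|` K2].
Proof.
move=> cK oU oV KUV.
have /(@normal_openP R)/(_ (K `\` U) (K `\` V)) := compact_normal hausdorffT compactT.
case.
- by rewrite setDE; apply: closedI => //; exact: open_closedC.
- by rewrite setDE; apply: closedI => //; exact: open_closedC.
- by apply/seteqP; split => // x [[/KUV[]]] // ? ? [].
move=> A [B [oA oB KUA KVB AB]]; exists (K `\` A), (K `\` B); split.
- by rewrite setDE; apply: closedI => //; exact: open_closedC.
- by rewrite setDE; apply: closedI => //; exact: open_closedC.
- by move=> x [Kx nAx]; apply: contrapT => nUx; apply/nAx/KUA.
- by move=> x [Kx nBx]; apply: contrapT => nVx; apply/nBx/KVB.
rewrite -setDIr AB setD0//.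
Qed.

Lemma inner_valueU U V : open U -> open V ->
  (inner_value (U `|` V) <= inner_value U + inner_value V)%E.
Proof.
move=> oU oV; apply: ge_ereal_sup => _ [K [cK KUV] <-].
have [K1 [K2 [cK1 cK2 K1U K2V ->]]] := closed_cover2 cK oU oV KUV.
rewrite (@le_trans _ _ (p K1 + p K2)%:E) ?lee_fin ?additive_subU//.
by rewrite EFinD leeD// inner_value_ge.
Qed.

Lemma inner_value_bigsetU (U : nat -> set T) n : (forall i, open (U i)) ->
  (inner_value (\big[setU/set0]_(i < n) U i) <= \sum_(i < n) inner_value (U i))%E.
Proof.
move=> oU; elim: n => [|n IH].
  by rewrite !big_ord0 (le_trans (inner_value_le _))// additive_set0.
rewrite !big_ord_recr/= (le_trans (inner_valueU _ _))//; last by rewrite leeD2r.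
by rewrite -bigcup_mkord; apply: bigcup_open => i _; exact: oU.
Qed.

(** A closed K inside the union is compact, so finitely many [U i] already cover it. *)
Lemma inner_value_bigcup (U : nat -> set T) : (forall i, open (U i)) ->
  (inner_value (\bigcup_i U i) <= \sum_(i <oo) inner_value (U i))%E.
Proof.
move=> oU; apply: ge_ereal_sup => _ [K [cK KU] <-].
have : compact K by apply: (subclosed_compact cK compactT).
rewrite compact_cover => /(_ _ setT U (fun i _ => oU i)) [|D _ KD].
  by move=> x /KU [i _ Ux]; exists i.
pose n := (\max_(i <- D) i).+1.
have Kn : K `<=` \big[setU/set0]_(i < n) U i.
  move=> x /KD[i iD Ux]; rewrite -bigcup_mkord; exists i => //=.
  by rewrite /n ltnS; exact: leq_bigmax_seq.
rewrite (le_trans (inner_value_ge cK Kn))//.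
rewrite (le_trans (inner_value_bigsetU _ oU))//.
rewrite -(big_mkord xpredT (fun i => inner_value (U i))).
by apply: nneseries_lim_ge => i _ _; exact: inner_value_ge0.
Qed.

Lemma outer_value_approx A (e : R) : 0 < e ->
  exists U, [/\ open U, A `<=` U & (inner_value U <= outer_value A + e%:E)%E].
Proof.
move=> e0; have := lb_ereal_inf_adherent e0 (outer_value_fin A).
by move=> [_ [U [oU AU] <-] /ltW UA]; exists U.
Qed.

Lemma outer_value_sigma_subadditive : sigma_subadditive outer_value.
Proof.
move=> F; apply/lee_addgt0Pr => e e0.
have en n : 0 < e / (2 ^ n.+1)%:R by rewrite divr_gt0// ltr0n expn_gt0.
have /choice[U UP] n := outer_value_approx (F n) (en n).
have oU n : open (U n) by have [] := UP n.
rewrite (@le_trans _ _ (inner_value (\bigcup_n U n)))//.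
  apply: ereal_inf_lbound; exists (\bigcup_n U n) => //; split.
    exact: bigcup_open.
  by apply: subset_bigcup => n _; have [] := UP n.
rewrite (le_trans (inner_value_bigcup oU))//.
apply: le_trans (epsilon_trick xpredT _ (ltW e0)); last first.
  by move=> n; exact: outer_value_ge0.
apply: lee_nneseries => [n _ _|n _]; first exact: inner_value_ge0.
by have [] := UP n.
Qed.

(** For W open around A, take a nearly optimal closed K in the intersection of W and U, then a
    nearly optimal closed L in [W \ K]. They are disjoint, so p is additive on them, and [W \ K]
    contains [A \ U] because K lies in U. *)
Lemma outer_value_open_caratheodory U : open U ->
  forall A, (outer_value (A `&` U) + outer_value (A `&` ~` U) <= outer_value A)%E.
Proof.
move=> oU A; apply: le_ereal_inf_tmp => _ [W [oW AW] <-].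
apply/lee_addgt0Pr => e e0.
have e2 : 0 < e / 2 by rewrite divr_gt0.
have oWU : open (W `&` U) by exact: openI.
have WUfin : inner_value (W `&` U) \is a fin_num.
  by rewrite -outer_value_open// outer_value_fin.
have [_ [K [cK KWU] <-] /ltW hK] := ub_ereal_sup_adherent e2 WUfin.
have oWK : open (W `\` K) by rewrite setDE; apply: openI => //; exact: closed_openC.
have WKfin : inner_value (W `\` K) \is a fin_num.
  by rewrite -outer_value_open// outer_value_fin.
have [_ [L [cL LWK] <-] /ltW hL] := ub_ereal_sup_adherent e2 WKfin.
have -> : e%:E = ((e / 2)%:E + (e / 2)%:E)%E by rewrite -EFinD -splitr.
have KL0 : K `&` L = set0.
  by apply/seteqP; split => // x [Kx /LWK[]].
have : ((p K)%:E + (p L)%:E <= inner_value W)%E.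
  rewrite -EFinD -pU// inner_value_ge//; first exact: closedU.
  by move=> x [/KWU[]//|/LWK[]].
move=> /(leeD2r ((e / 2)%:E + (e / 2)%:E)%E); apply: le_trans.
rewrite addeACA; apply: leeD.
  rewrite -leeBlDr// (le_trans _ hK)// leeD2r//.
  rewrite -[leRHS]/(inner_value (W `&` U)) -outer_value_open//.
  by apply: le_outer_value; exact: setSI.
rewrite -leeBlDr// (le_trans _ hL)// leeD2r//.
rewrite -[leRHS]/(inner_value (W `\` K)) -outer_value_open//.
apply: le_outer_value => x [/AW Wx nUx]; split => //.
by move=> /KWU[].
Qed.

End Finitely_additive.

(** Caratheodory's construction applied to [outer_value]: open sets are measurable for it, hence so
    are Borel sets. The one-sided comparisons with p suffice to recover integrals of continuous
    functions. *)
Lemma finitely_additive_borel_measure (R : realType) (G : topologicalZmodType)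
    (p : set G -> R) :
  compact [set: G] -> hausdorff_space G -> (forall A, 0 <= p A) ->
  (forall A B, A `&` B = set0 -> p (A `|` B) = p A + p B) ->
  exists nu : {finite_measure set (Borel G) -> \bar R},
    [/\ forall K : set G, closed K -> ((p K)%:E <= nu K)%E,
        forall U : set G, open U -> (nu U <= (p U)%:E)%E &
        forall (A : set G) (e : R), 0 < e ->
          exists U : set G, [/\ open U, A `<=` U & (nu U <= nu A + e%:E)%E]].
Proof.
move=> compactG hausdorffG p_ge0 pU.
pose T : ptopologicalType := HB.pack_for ptopologicalType (G : Type) G (isPointed.Build G 0).
pose mu : {outer_measure set T -> \bar R} := HB.pack_for
  {outer_measure set T -> \bar R} (@outer_value R T p)
  (isOuterMeasure.Build R T (@outer_value R T p)
    (@outer_value_set0 R T p p_ge0 pU)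
    (@outer_value_ge0 R T p pU)
    (@le_outer_value R T p)
    (@outer_value_sigma_subadditive R T p compactG hausdorffG p_ge0 pU)).
have sub (A : set (Borel G)) : measurable A -> mu.-cara.-measurable A.
  apply: smallest_sub; first exact: sigma_algebra_measurable.
  move=> U oU; apply: le_caratheodory_measurable.
  exact: (@outer_value_open_caratheodory R T p p_ge0 pU).
pose nu0 : set (Borel G) -> \bar R := mu.
have nu00 : nu0 set0 = 0%E by exact: outer_measure0.
have nu0_ge0 A : (0 <= nu0 A)%E by exact: outer_measure_ge0.
have nu0_additive : semi_sigma_additive nu0.
  move=> F mF tF mUF; apply: (caratheodory_measure_sigma_additive (mu := mu)) => //.
    by move=> n; exact: (sub _ (mF n)).
  exact: (sub _ mUF).
have nu0_fin : fin_num_fun nu0.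
  by move=> A _; exact: (@outer_value_fin R T p p_ge0 pU).
pose nu1 := isMeasure.Build _ (Borel G) R nu0 nu00 nu0_ge0 nu0_additive.
pose nu2 : {measure set (Borel G) -> \bar R} :=
  HB.pack_for {measure set (Borel G) -> \bar R} nu0 nu1.
pose nu3 := Measure_isFinite.Build _ (Borel G) R nu2 nu0_fin.
pose nu : {finite_measure set (Borel G) -> \bar R} :=
  HB.pack_for {finite_measure set (Borel G) -> \bar R} nu0 nu1 nu3.
exists nu; split.
- move=> K cK; apply: le_ereal_inf_tmp => _ [U [oU KU] <-].
  exact: (@inner_value_ge R T p).
- move=> U oU; rewrite [leLHS](@outer_value_open R T p U oU).
  exact: (@inner_value_le R T p p_ge0 pU).
- move=> A e e0; have [U [oU AU UA]] := @outer_value_approx R T p p_ge0 pU A e e0.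
  exists U; split => //.
  by rewrite [leLHS](@outer_value_open R T p U oU).
Qed.

(** Compactness of [[-c, c]] gives a cluster point, and an ultrafilter converges to its cluster
    points. *)
Lemma ultrafilter_bounded_cvg (R : realType) (I : Type) (F : set_system I)
    (h : I -> R) (c : R) : UltraFilter F -> (forall i, `|h i| <= c) ->
  cvg (h i @[i --> F]).
Proof.
move=> FU hc; have : compact `[- c, c] by exact: segment_compact.
move=> /(_ (h i @[i --> F])) [|x [_ xF]].
  by apply: nearW => i /=; rewrite in_itv/= -ler_norml.
apply/cvg_ex; exists x => V Vx.
case: (in_ultra_setVsetC (h @^-1` V) FU) => [|FV]; first by [].
by have [y [/=]] := xF (~` V) V FV Vx.
Qed.

Lemma cvg_finite_sum (R : realType) (I J : Type) (F : set_system I) (r : seq J)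
    (f : J -> I -> R) (l : J -> R) : Filter F ->
  (forall j, f j i @[i --> F] --> l j) ->
  \sum_(j <- r) f j i @[i --> F] --> \sum_(j <- r) l j.
Proof.
move=> FF fl; elim: r => [|j r IH].
  by under eq_fun do rewrite big_nil; rewrite big_nil; exact: cvg_cst.
by under eq_fun do rewrite big_cons; rewrite big_cons; exact: cvgD.
Qed.

(** The sum is the integer part of y, written so that for y a multiple of [f x] it becomes a sum of
    indicators of superlevel sets of f. *)
Lemma staircase_bounds (R : realType) n (y : R) : 0 <= y <= n%:R ->
  \sum_(j < n) (j.+1%:R <= y)%R%:R <= y <= \sum_(j < n) (j.+1%:R <= y)%R%:R + 1.
Proof.
elim: n => [|n IH]; first by rewrite big_ord0 add0r => /andP[-> /le_trans ->].
move=> /andP[y0 yn]; rewrite big_ord_recr/=; have [yn'|ny] := leP y n%:R.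
  have -> : (n.+1%:R <= y) = false.
    by apply/negbTE; rewrite -ltNge (le_lt_trans yn')// ltr_nat.
  by rewrite addr0 IH// y0.
rewrite (eq_bigr (fun=> 1)) => [|j _]; last first.
  by rewrite (le_trans _ (ltW ny))// ler_nat.
rewrite sumr_const card_ord; have [h|h] := leP n.+1%:R y.
  have -> : y = n.+1%:R by apply/eqP; rewrite eq_le yn h.
  by rewrite natr1 lexx lerDl ler01.
by rewrite addr0 natr1 yn (ltW ny).
Qed.

Lemma continuous_borel_measurable (R : realType) (G : topologicalZmodType)
    (f : G -> R) : continuous f -> measurable_fun setT (f : Borel G -> R).
Proof.
move=> /continuousP cf; apply: (measurability _ (RGenOpens.measurableE R)).
move=> _ [_ [a [b ->]] <-]; rewrite setTI; apply: sub_sigma_algebra.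
by apply: cf; exact: interval_open.
Qed.

Lemma closed_borel (G : topologicalZmodType) (K : set G) :
  closed K -> measurable (K : set (Borel G)).
Proof.
move=> cK; rewrite -(setCK K); apply: measurableC.
by apply: sub_sigma_algebra; exact: closed_openC.
Qed.

(** * Weak limits of positive point measures *)

Section Weak_limit.
Variables (R : realType) (G : topologicalZmodType).

Definition point_integral (s : seq (R * G)) (f : G -> R) : R :=
  \sum_(w <- s) w.1 * f w.2.

Definition point_mass (s : seq (R * G)) (A : set G) : R :=
  point_integral s (\1_A).

Lemma borel_bounded_integrable (nu : {finite_measure set (Borel G) -> \bar R})
    (f : G -> R) (c : R) : measurable_fun setT (f : Borel G -> R) ->
  (forall x, `|f x| <= c) -> nu.-integrable setT (EFin \o f).
Proof.
move=> mf fc; apply: measurable_bounded_integrable => //.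
  by rewrite -ge0_fin_numE// fin_num_measure.
exists c; split; first exact: num_real.
by move=> r cr x _ /=; rewrite (le_trans (fc x))// ltW.
Qed.

Variables (I : Type) (F : set_system I) (s : I -> seq (R * G)) (c : R).
Hypothesis compactG : compact [set: G].
Hypothesis hausdorffG : hausdorff_space G.
Hypothesis FU : UltraFilter F.
Hypothesis s_ge0 : forall i, all (fun w => 0 <= w.1) (s i).
Hypothesis s_le : forall i, \sum_(w <- s i) w.1 <= c.

Lemma point_integral_bound f i : (forall x, `|f x| <= 1) ->
  `|point_integral (s i) f| <= c.
Proof.
move=> f1; rewrite (le_trans _ (s_le i))// (le_trans (ler_norm_sum _ _ _))//.
rewrite big_seq [leRHS]big_seq; apply: ler_sum => w /(allP (s_ge0 i)) w0.
by rewrite normrM ger0_norm// ler_piMr.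
Qed.

Lemma point_integral_cvg f : (forall x, `|f x| <= 1) ->
  point_integral (s i) f @[i --> F] --> lim (point_integral (s i) f @[i --> F]).
Proof.
move=> f1; apply: (@ultrafilter_bounded_cvg _ _ _ _ c) => i.
exact: point_integral_bound.
Qed.

Lemma ultrafilter_le (g h : I -> R) a b : g i @[i --> F] --> a ->
  h i @[i --> F] --> b -> (forall i, g i <= h i) -> a <= b.
Proof.
move=> ga hb gh; rewrite -subr_ge0.
apply: (@closed_cvg _ _ F _ (fun i => h i - g i) [set x : R | 0 <= x]).
- exact: closed_ge.
- by apply: nearW => i /=; rewrite subr_ge0.
- exact: cvgB.
Qed.

Let p (A : set G) : R := lim (point_mass (s i) A @[i --> F]).

Let indic_le1 (A : set G) x : `|\1_A x : R| <= 1.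
Proof. by rewrite indicE ger0_norm// lern1 leq_b1. Qed.

Let p_cvg A : point_mass (s i) A @[i --> F] --> p A.
Proof. exact: point_integral_cvg. Qed.

Let p_ge0 A : 0 <= p A.
Proof.
have c0 : (fun=> 0 : R) i @[i --> F] --> (0 : R) by exact: cvg_cst.
apply: (ultrafilter_le c0 (@p_cvg A)) => i.
rewrite /point_mass /point_integral big_seq sumr_ge0// => w /(allP (s_ge0 i)) w0.
by rewrite mulr_ge0// indicE.
Qed.

Let pU A B : A `&` B = set0 -> p (A `|` B) = p A + p B.
Proof.
move=> AB; apply: (cvg_unique _ (@p_cvg (A `|` B))) => //.
rewrite (_ : (fun i => _) = fun i => point_mass (s i) A + point_mass (s i) B).
  exact: cvgD.
apply/funext => i; rewrite /point_mass /point_integral -big_split/=.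
apply: eq_bigr => w _; rewrite -mulrDr; congr (_ * _).
have : w.2 \in A `&` B = false by rewrite AB in_set0.
rewrite !indicE in_setI in_setU.
by case: (w.2 \in A); case: (w.2 \in B); rewrite ?addr0 ?add0r.
Qed.

(** Layer-cake comparison: [n.+1 * f] exceeds the sum of the indicators of the closed sets [K j] by
    at most 1, which costs [c / n.+1] in the limit, and [p (K j) <= nu (K j)] bounds the rest by the
    integral. *)
Let limit_le_integral (nu : {finite_measure set (Borel G) -> \bar R})
    (f : G -> R) (l : R) :
  (forall K : set G, closed K -> ((p K)%:E <= nu K)%E) ->
  continuous f -> (forall x, 0 <= f x <= 1) ->
  point_integral (s i) f @[i --> F] --> l -> l <= Rintegral nu setT f.
Proof.
move=> pnu cf f01 fl.
have f1 x : `|f x| <= 1 by have /andP[? ?] := f01 x; rewrite ger0_norm.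
have mf := continuous_borel_measurable cf.
have intf := borel_bounded_integrable nu mf f1.
suff hn n : l <= Rintegral nu setT f + c / n.+1%:R.
  apply/ler_addgt0Pr => e e0; pose n := Num.bound (`|c| / e).
  rewrite (le_trans (hn n))// lerD2l ler_pdivrMr// (le_trans (ler_norm c))//.
  rewrite mulrC -ler_pdivrMr//.
  have : `|c| / e < n%:R by apply: archi_boundP; rewrite divr_ge0// ltW.
  by move=> /ltW/le_trans -> //; rewrite ler_nat.
pose K j := [set x | j.+1%:R <= n.+1%:R * f x].
have cK j : closed (K j).
  rewrite (_ : K j = (fun x => n.+1%:R * f x) @^-1` [set y | j.+1%:R <= y])//.
  apply: closed_comp; last exact: closed_ge.
  by move=> x _; apply: cvgM; [exact: cvg_cst|exact: cf].
have mK j : measurable (K j : set (Borel G)) by exact: closed_borel.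
have st x : \sum_(j < n.+1) \1_(K j) x <= n.+1%:R * f x <=
    \sum_(j < n.+1) \1_(K j) x + 1.
  have := @staircase_bounds R n.+1 (n.+1%:R * f x).
  have /andP[f0 f1'] := f01 x; rewrite mulr_ge0//= ler_piMr// => /(_ isT).
  rewrite (eq_bigr (fun j : 'I_n.+1 => \1_(K j) x))// => j _.
  by rewrite indicE; congr (_%:R); rewrite /K/= mem_setE.
have pK : \sum_(j < n.+1) p (K j) <= n.+1%:R * Rintegral nu setT f.
  have nf x : 0 <= n.+1%:R * f x by have /andP[? _] := f01 x; rewrite mulr_ge0.
  have mnf : measurable_fun setT ((fun x => n.+1%:R * f x) : Borel G -> R).
    exact: measurable_funM.
  have intnf : nu.-integrable setT (EFin \o (fun x => n.+1%:R * f x)).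
    apply: (@borel_bounded_integrable nu _ n.+1%:R) => // x.
    by rewrite ger0_norm// ler_piMr//; have /andP[] := f01 x.
  rewrite -RintegralZl// -lee_fin /Rintegral fineK; last exact: integrable_fin_num.
  rewrite -sumEFin (@le_trans _ _ (\sum_(j < n.+1) nu (K j))%E)//.
    by apply: lee_sum => j _; exact: pnu.
  rewrite (eq_bigr (fun j : 'I_n.+1 => \int[nu]_x (\1_(K j) x)%:E)%E) => [|j _].
    2: by rewrite integral_indic// setIT.
  have mK1 j : measurable_fun setT (fun x : Borel G => (\1_(K j) x : R)%:E).
    by apply/measurable_EFinP; exact: measurable_indic.
  have K1 j (x : G) : (0 <= (\1_(K j) x : R)%:E)%E by rewrite lee_fin indicE.
  rewrite -ge0_integral_sum//.
  apply: ge0_le_integral => //.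
  - by move=> x _; apply: sume_ge0.
  - by apply: emeasurable_sum => j.
  - exact/measurable_EFinP.
  - by move=> x _; rewrite sumEFin lee_fin; have /andP[] := st x.
suff h : l <= c / n.+1%:R + n.+1%:R^-1 * \sum_(j < n.+1) p (K j).
  rewrite (le_trans h)// addrC lerD2r ler_pdivrMl//.
have hcvg : (fun i => c / n.+1%:R + n.+1%:R^-1 *
     \sum_(j < n.+1) point_mass (s i) (K j)) i @[i --> F] -->
    c / n.+1%:R + n.+1%:R^-1 * \sum_(j < n.+1) p (K j).
  apply: cvgD; first exact: cvg_cst.
  apply: cvgM; first exact: cvg_cst.
  by apply: cvg_finite_sum => j; exact: p_cvg.
apply: (ultrafilter_le fl hcvg) => i.
rewrite /point_mass /point_integral exchange_big/=.
rewrite (@le_trans _ _ (\sum_(w <- s i) (w.1 / n.+1%:R + n.+1%:R^-1 *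
    \sum_(j < n.+1) w.1 * \1_(K j) w.2)))//.
  rewrite big_seq [leRHS]big_seq; apply: ler_sum => w /(allP (s_ge0 i)) w0.
  rewrite -mulr_sumr mulrCA -mulrDr ler_wpM2l//.
  rewrite -[X in X + _]mulr1 -mulrDr ler_pdivlMl// addrC.
  by have /andP[] := st w.2.
by rewrite big_split/= -mulr_suml -mulr_sumr lerD2r ler_wpM2r.
Qed.

Lemma weak_limit : exists nu : {finite_measure set (Borel G) -> \bar R},
  (forall (A : set G) (e : R), 0 < e ->
     exists U : set G, [/\ open U, A `<=` U & (nu U <= nu A + e%:E)%E]) /\
  (forall f : G -> R, continuous f -> (forall x, `|f x| <= 1) ->
     point_integral (s i) f @[i --> F] --> Rintegral nu setT f).
Proof.
have [nu [nu_closed nu_open nu_outer]] :=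
  finitely_additive_borel_measure compactG hausdorffG p_ge0 pU.
exists nu; split => //.
(* The whole group is both open and closed, so the regularization preserves the total mass. *)
have nuT : fine (nu setT) = p setT.
  have : nu setT = (p setT)%:E.
    by apply/eqP; rewrite eq_le nu_open ?nu_closed//; exact: openT.
  by move=> ->.
have le f l : continuous f -> (forall x, `|f x| <= 1) ->
    point_integral (s i) f @[i --> F] --> l -> l <= Rintegral nu setT f.
  (* An affine change brings f into [[0, 1]]; by [nuT] the added constant contributes equally to
     both sides. *)
  move=> cf f1 fl; pose g x := 2^-1 * (f x + 1).
  have intf := borel_bounded_integrable nu (continuous_borel_measurable cf) f1.
  have int1 : nu.-integrable setT (EFin \o (fun=> 1)).
    by apply: (@borel_bounded_integrable nu _ 1) => // x; rewrite normr1.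
  have gE : Rintegral nu setT g = 2^-1 * (Rintegral nu setT f + p setT).
    rewrite RintegralZl//; first by rewrite RintegralD// Rintegral_cst// mul1r nuT.
    apply: (@borel_bounded_integrable nu _ 2).
      apply: measurable_funD => //; exact: continuous_borel_measurable.
    by move=> x; rewrite (le_trans (ler_normD _ _))// normr1 -[leRHS]/(1 + 1) lerD2r.
  have := @limit_le_integral nu g (2^-1 * (l + p setT)) nu_closed.
  rewrite gE ler_pM2l ?invr_gt0// lerD2r; apply.
  - by move=> x; apply: cvgM; [exact: cvg_cst|apply: cvgD; [exact: cf|exact: cvg_cst]].
  - by move=> x; have := f1 x; rewrite ler_norml /g; lra.
  - rewrite (_ : (fun i => _) = fun i => 2^-1 * (point_integral (s i) f + point_mass (s i) setT)).
      by apply: cvgM; [exact: cvg_cst|apply: cvgD => //; exact: p_cvg].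
    apply/funext => i; rewrite /point_mass /point_integral -big_split/= mulr_sumr.
    by apply: eq_bigr => w _; rewrite indicT /g /=; ring.
move=> f cf f1; have fl := point_integral_cvg f1.
rewrite (_ : Rintegral nu setT f = lim (point_integral (s i) f @[i --> F]))//.
(* The reverse inequality is [le] for [- f]. *)
apply/eqP; rewrite eq_le (le _ _ cf f1 fl) andbT -lerN2.
have -> : - Rintegral nu setT f = Rintegral nu setT (fun x => - f x).
  rewrite -mulN1r -RintegralZl//.
    by apply: eq_Rintegral => x _; rewrite mulN1r.
  exact: borel_bounded_integrable (continuous_borel_measurable cf) f1.
apply: le.
- by move=> x; apply: cvgN; exact: cf.
- by move=> x; rewrite normrN.
rewrite (_ : (fun i => _) = fun i => - point_integral (s i) f); first exact: cvgN.
apply/funext => i; rewrite /point_integral -sumrN; apply: eq_bigr => w _.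
by rewrite mulrN.
Qed.

End Weak_limit.

(** * Complex measures *)

Lemma ereal_subr_add (R : realDomainType) (a b c e : \bar R) :
  a \is a fin_num -> b \is a fin_num -> c \is a fin_num -> e \is a fin_num ->
  (a - b = c - e)%E -> (c + b = a + e)%E.
Proof.
case: a b c e => [a| |] [b| |] [c| |] [e| |] //= _ _ _ _ [] h.
by rewrite -!EFinD; congr (_%:E); move: h; lra.
Qed.

Section Charge_difference.
Context d (T : measurableType d) (R : realType).
Variables p n : {finite_measure set T -> \bar R}.

Definition charge_difference : {charge set T -> \bar R} :=
  cadd (charge_of_finite_measure p) (copp (charge_of_finite_measure n)).

Lemma charge_differenceE A : charge_difference A = (p A - n A)%E.
Proof. by []. Qed.

(** Whichever Hahn decomposition was chosen, [jordan_pos PN + n] and [p + jordan_neg PN] are the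
    same measure; integrate f against both and rearrange. *)
Lemma charge_integral_difference (f : T -> R) c :
  measurable_fun setT f -> (forall x, `|f x| <= c) ->
  charge_integral charge_difference f = Rintegral p setT f - Rintegral n setT f.
Proof.
move=> mf fc; rewrite /charge_integral.
case: cid => P exN; case: cid => N PN.
have intf (m : {finite_measure set T -> \bar R}) : m.-integrable setT (EFin \o f).
  apply: measurable_bounded_integrable => //.
    by rewrite -ge0_fin_numE// fin_num_measure.
  exists c; split; first exact: num_real.
  by move=> r cr x _ /=; rewrite (le_trans (fc x))// ltW.
have addE A : measurable A -> A `<=` setT ->
    measure_add (jordan_pos PN) n A = measure_add p (jordan_neg PN) A.
  move=> mA _; rewrite !measure_addE.
  have : (p A - n A = jordan_pos PN A - jordan_neg PN A)%E.
    rewrite -charge_differenceE (jordan_decomp PN mA).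
    by rewrite -[LHS]/(jordan_pos PN A + (-1)%:E * jordan_neg PN A)%E mulN1e.
  have pf : p A \is a fin_num by exact: fin_num_measure.
  have nf : n A \is a fin_num by exact: fin_num_measure.
  have jpf : jordan_pos PN A \is a fin_num by exact: fin_num_measure.
  have jnf : jordan_neg PN A \is a fin_num by exact: fin_num_measure.
  exact: ereal_subr_add pf nf jpf jnf.
have : (\int[measure_add (jordan_pos PN) n]_x (f x)%:E =
    \int[measure_add p (jordan_neg PN)]_x (f x)%:E)%E.
  exact: eq_measure_integral.
rewrite !integral_measure_add//; last 4 first; try exact: intf.
have fin (m : {finite_measure set T -> \bar R}) :
    (\int[m]_x (f x)%:E)%E = (Rintegral m setT f)%:E.
  by rewrite /Rintegral fineK//; exact: (integrable_fin_num _ (intf m)).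
by rewrite !fin -!EFinD => -[h]; lra.
Qed.

End Charge_difference.

(** * Total variation of complex measures *)

Section Variation.
Variable R : realType.

Definition modulus (z : R[i]) : R := complex.Re `|z|.

Lemma modulusE z : (modulus z)%:C%C = `|z|.
Proof. by rewrite /modulus RRe_real// normr_real. Qed.

Lemma modulus_ge0 z : 0 <= modulus z.
Proof. by rewrite -ler0c modulusE. Qed.

Lemma modulusD z w : modulus (z + w) <= modulus z + modulus w.
Proof. by rewrite -lecR rmorphD/= !modulusE ler_normD. Qed.

Lemma modulus_le (a b : R) : modulus (a +i* b)%C <= `|a| + `|b|.
Proof.
rewrite /modulus normc_def/= -[leRHS]ger0_norm ?addr_ge0// -sqrtr_sqr.
rewrite ler_wsqrtr// sqrrD !real_normK ?num_real// lerD2r lerDl.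
by rewrite mulrn_wge0// mulr_ge0.
Qed.

Context d (T : measurableType d).
Variable mu : complex_measure T R.
Implicit Types A B : set T.

Let val_setU A B : measurable A -> measurable B -> A `&` B = set0 ->
  mu (A `|` B) = mu A + mu B.
Proof.
move=> mA mB AB; rewrite /complex_measure_val !chargeU//.
by rewrite !fineD ?fin_num_measure.
Qed.

Lemma complex_variation_le A B : measurable A -> measurable B -> A `<=` B ->
  (complex_variation mu A <= complex_variation mu B)%E.
Proof.
move=> mA mB AB; apply: ge_ereal_sup => _ [F [mF tF FA] <-].
(* Putting [B \ A] in front turns a partition of A into one of B. *)
pose F' n := if n is m.+1 then F m else B `\` A.
rewrite (@le_trans _ _ (\sum_(0 <= n <oo) (complex.Re `|mu (F' n)|)%:E)%E)//.
  have ge0 k : (0 <= (complex.Re `|mu (F' k)|)%:E)%E.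
    rewrite lee_fin. exact: (modulus_ge0 (mu (F' k))).
  rewrite [leRHS]nneseries_recl// -(nneseries_addn 1 ge0).
  rewrite [X in (_ <= _ + X)%E](_ : _ =
      \sum_(0 <= n <oo) (complex.Re `|mu (F n)|)%:E)%E; first exact: leeDr.
  by apply: eq_eseriesr => n _; rewrite addn1.
apply: ereal_sup_ubound; exists F' => //; split.
- by case=> [|n]; [exact: measurableD|exact: mF].
- apply/trivIsetP => -[|i] [|j] _ _ //= ij.
  + by apply/seteqP; split => // x [[_ nA] Fx]; apply: nA; rewrite -FA; exists j.
  + by apply/seteqP; split => // x [Fx [_ nA]]; apply: nA; rewrite -FA; exists i.
  + by move/trivIsetP : tF => tF; apply: tF => //; rewrite -eqSS.
- apply/seteqP; split => [x [[|n] _ /=]|x Bx]; first by case.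
    by move=> Fx; apply: AB; rewrite -FA; exists n.
  have [Ax|nAx] := pselect (A x); last by exists 0%N.
  by move: Ax; rewrite -FA => -[n _ Fx]; exists n.+1.
Qed.

Lemma complex_variationU A B : measurable A -> measurable B -> A `&` B = set0 ->
  (complex_variation mu (A `|` B) <= complex_variation mu A + complex_variation mu B)%E.
Proof.
move=> mA mB AB; apply: ge_ereal_sup => _ [F [mF tF FA] <-].
have part D : D `<=` A `|` B -> measurable D ->
    (\sum_(0 <= n <oo) (modulus (mu (F n `&` D)))%:E <= complex_variation mu D)%E.
  move=> DAB mD; apply: ereal_sup_ubound; exists (fun n => F n `&` D) => //; split.
  - by move=> n; exact: measurableI.
  - exact: trivIset_setIr.
  - by rewrite -setI_bigcupl FA setIidr.
apply: le_trans (leeD (part A _ mA) (part B _ mB)); last 2 first.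
- exact: subsetUl.
- exact: subsetUr.
rewrite -nneseriesD; last 2 first.
- by move=> n _ _; rewrite lee_fin modulus_ge0.
- by move=> n _ _; rewrite lee_fin modulus_ge0.
apply: lee_nneseries => n _; first by move=> _; rewrite lee_fin (modulus_ge0 (mu (F n))).
rewrite -EFinD lee_fin -[leLHS]/(modulus _).
have -> : mu (F n) = mu (F n `&` A) + mu (F n `&` B).
  rewrite -val_setU; [|exact: measurableI|exact: measurableI|].
    by rewrite -setIUr setIidl// -FA; exact: bigcup_sup.
  by rewrite setIACA AB setI0.
exact: modulusD.
Qed.

Lemma complex_variation_dominated (tot : {measure set T -> \bar R}) A :
  (forall B, measurable B -> ((modulus (mu B))%:E <= tot B)%E) -> measurable A ->
  (complex_variation mu A <= tot A)%E.
Proof.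
move=> le_tot mA; apply: ge_ereal_sup => _ [F [mF tF FA] <-].
have : tot A = (\sum_(0 <= n <oo) tot (F n))%E.
  rewrite -FA; apply/esym/cvg_lim => //.
  by apply: measure_semi_sigma_additive => //; rewrite FA.
move=> ->; apply: lee_nneseries => n _; first by move=> _; rewrite lee_fin (modulus_ge0 (mu (F n))).
exact: le_tot.
Qed.

End Variation.

(** * Regularity of complex combinations of outer regular measures *)

Section Regularity.
Variables (R : realType) (G : topologicalZmodType).
Hypothesis compactG : compact [set: G].
Hypothesis hausdorffG : hausdorff_space G.

Definition outer_regular (nu : set (Borel G) -> \bar R) :=
  forall (A : set G) (e : R), 0 < e ->
    exists U : set G, [/\ open U, A `<=` U & (nu U <= nu A + e%:E)%E].

Lemma open_borel (U : set G) : open U -> measurable (U : set (Borel G)).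
Proof. by move=> oU; exact: sub_sigma_algebra. Qed.

Lemma outer_regular_setD (nu : {finite_measure set (Borel G) -> \bar R})
    (A : set (Borel G)) (e : R) : outer_regular nu -> measurable A -> 0 < e ->
  exists U : set G, [/\ open U, A `<=` U & (nu (U `\` A) <= e%:E)%E].
Proof.
move=> reg mA e0; have [U [oU AU UA]] := reg A e e0; exists U; split => //.
have mU := open_borel oU.
rewrite measureD//; last by rewrite -ge0_fin_numE// fin_num_measure.
by rewrite setIidr// leeBlDl// fin_num_measure.
Qed.

Lemma measure_openD_le (nu : {measure set (Borel G) -> \bar R}) (U V : set G)
    (A : set (Borel G)) : open U -> open V -> measurable A -> U `<=` V ->
  (nu (U `\` A) <= nu (V `\` A))%E.
Proof.
move=> oU oV mA UV; apply: le_measure.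
- apply: mem_set; exact: (@measurableD _ (Borel G) U A (open_borel oU) mA).
- apply: mem_set; exact: (@measurableD _ (Borel G) V A (open_borel oV) mA).
- exact: setSD.
Qed.

Lemma outer_regular_add (nu1 nu2 : {finite_measure set (Borel G) -> \bar R}) :
  outer_regular nu1 -> outer_regular nu2 ->
  forall (A : set (Borel G)) (e : R), measurable A -> 0 < e ->
  exists U : set G, [/\ open U, A `<=` U &
    (nu1 (U `\` A) <= e%:E)%E /\ (nu2 (U `\` A) <= e%:E)%E].
Proof.
move=> reg1 reg2 A e mA e0.
have [U [oU AU hU]] := outer_regular_setD reg1 mA e0.
have [V [oV AV hV]] := outer_regular_setD reg2 mA e0.
exists (U `&` V); split; [exact: openI|by rewrite subsetI|].
have oUV := openI oU oV.
by split; [apply: le_trans hU|apply: le_trans hV];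
  apply: measure_openD_le => // x [].
Qed.

Variables p1 n1 p2 n2 : {finite_measure set (Borel G) -> \bar R}.
Hypothesis reg : [/\ outer_regular p1, outer_regular n1, outer_regular p2 &
  outer_regular n2].

Let mu : complex_measure (Borel G) R :=
  ComplexMeasure (charge_difference p1 n1) (charge_difference p2 n2).

Let tot : {measure set (Borel G) -> \bar R} :=
  measure_add (measure_add p1 n1) (measure_add p2 n2).

Let totE A : tot A = (p1 A + n1 A + (p2 A + n2 A))%E.
Proof. by apply: etrans (measure_addE _ _ A) _; congr (_ + _)%E; exact: measure_addE. Qed.

Let mu_le_tot A : measurable A -> ((modulus (mu A))%:E <= tot A)%E.
Proof.
move=> mA; rewrite totE.
have fin (m : {finite_measure set (Borel G) -> \bar R}) :
    exists2 a : R, m A = a%:E & 0 <= a.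
  exists (fine (m A)); first by rewrite fineK// fin_num_measure.
  by rewrite fine_ge0.
have [a1 p1E a10] := fin p1; have [b1 n1E b10] := fin n1.
have [a2 p2E a20] := fin p2; have [b2 n2E b20] := fin n2.
rewrite /mu /complex_measure_val/= !charge_differenceE p1E n1E p2E n2E.
rewrite -!EFinD lee_fin (le_trans (modulus_le _ _))//=.
rewrite lerD// (le_trans (ler_normB _ _))// !ger0_norm//.
Qed.

Let approx (A : set (Borel G)) (e : R) : measurable A -> 0 < e ->
  exists U : set G, [/\ open U, A `<=` U & (tot (U `\` A) <= e%:E)%E].
Proof.
move=> mA e0; have [r1 r2 r3 r4] := reg.
have e4 : 0 < e / 4%:R by rewrite divr_gt0.
have [U [oU AU [h1 h2]]] := outer_regular_add r1 r2 mA e4.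
have [V [oV AV [h3 h4]]] := outer_regular_add r3 r4 mA e4.
exists (U `&` V); split; [exact: openI|by rewrite subsetI|].
rewrite totE (_ : e = e / 4%:R + e / 4%:R + (e / 4%:R + e / 4%:R)); last by field.
rewrite !EFinD; apply: leeD; apply: leeD;
  [apply: le_trans h1|apply: le_trans h2|apply: le_trans h3|apply: le_trans h4];
  by apply: measure_openD_le (openI oU oV) _ _ _ => // x [].
Qed.

(** The variation is monotone, subadditive on disjoint pairs, and dominated by [tot], the sum of the
    four measures, which is small on [U \ A]. *)
Lemma complex_difference_regular : regular_measure mu.
Proof.
move=> A mA; split; apply/eqP; rewrite eq_le; apply/andP; split.
- apply: le_ereal_inf_tmp => _ [U [oU AU] <-].
  by apply: complex_variation_le => //; exact: open_borel.
- apply/lee_addgt0Pr => e e0; have [U [oU AU hU]] := approx mA e0.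
  have mU := open_borel oU.
  apply: (@le_trans _ _ (complex_variation mu U)).
    by apply: ereal_inf_lbound; exists U => //; split.
  rewrite -(setDUK AU) (le_trans (complex_variationU _ mA _ _))//.
  + exact: measurableD.
  + by rewrite setDE setICA setICr setI0.
  rewrite leeD2l// (le_trans _ hU)//; apply: complex_variation_dominated => //.
  exact: measurableD.
- apply/lee_addgt0Pr => e e0.
  have mCA : measurable (~` A) by exact: measurableC.
  have [U [oU AU hU]] := approx mCA e0.
  have mU := open_borel oU.
  have cK : closed (~` U : set G) by exact: open_closedC.
  have KA : ~` U `<=` A by rewrite -[A]setCK; exact: subsetC.
  have mK : measurable (~` U : set (Borel G)) by exact: measurableC.
  rewrite -[in leLHS](setDUK KA) (le_trans (complex_variationU _ mK _ _))//.
  + exact: measurableD.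
  + by rewrite setDE setICA setICr setI0.
  apply: leeD.
    apply: ereal_sup_ubound; exists (~` U) => //; split => //.
    exact: subclosed_compact compactG _.
  rewrite (le_trans _ hU)// (_ : A `\` ~` U = U `\` ~` A).
    by apply: complex_variation_dominated => //; exact: measurableD.
  by rewrite !setDE !setCK setIC.
- apply: ge_ereal_sup => _ [K [cK KA] <-]; apply: complex_variation_le => //.
  by apply: closed_borel; exact: compact_closed.
Qed.

End Regularity.

(** * Sidon sets *)

Section Sidon.
Variable R : realType.

(** The instance for [R[i]] of the Archimedean hypothesis [arch]; x and e are real because they are
    comparable with 0. *)
Lemma complex_expr_small (x e : R[i]) : 0 <= x < 1 -> 0 < e ->
  exists n, x ^+ n <= e.
Proof.
have toR (z : R[i]) : 0 <= z -> z = (complex.Re z)%:C%C.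
  by move=> z0; rewrite RRe_real// ger0_real.
move=> /andP[x0 x1] e0; have xE := toR x x0; have eE := toR e (ltW e0).
rewrite xE in x0 x1 *; rewrite eE in e0 *.
set a := complex.Re x in x0 x1 *; set b := complex.Re e in e0 *.
have a1 : `|a| < 1 by rewrite ger0_norm -?ler0c// -ltcR.
have b0 : 0 < b by rewrite -ltcR.
have /cvgrPdist_le /(_ _ b0) [N _ /(_ N (leqnn N))] := cvg_expr a1.
rewrite sub0r normrN => aN; exists N.
by rewrite -rmorphXn lecR (le_trans (ler_norm _)).
Qed.

Lemma ReB (z w : R[i]) : complex.Re (z - w) = complex.Re z - complex.Re w.
Proof. by case: z w => [a b] [a' b']. Qed.

Lemma ImB (z w : R[i]) : complex.Im (z - w) = complex.Im z - complex.Im w.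
Proof. by case: z w => [a b] [a' b']. Qed.

Lemma Re_le_modulus (z : R[i]) : `|complex.Re z| <= modulus z.
Proof. by rewrite -lecR modulusE normc_ge_Re. Qed.

Lemma Im_le_modulus (z : R[i]) : `|complex.Im z| <= modulus z.
Proof. by rewrite /modulus normc_def/= -sqrtr_sqr ler_wsqrtr// lerDr sqr_ge0. Qed.

Variable G : topologicalZmodType.
Implicit Types gamma : character R G.

Lemma character_ext gamma gamma' : (forall x, gamma x = gamma' x) -> gamma = gamma'.
Proof.
case: gamma gamma' => f cf fD f1 [g cg gD g1] /= /funext fg.
by subst g; congr Character; exact: Prop_irrelevance.
Qed.

Lemma character_part_continuous (h : R[i] -> R) gamma :
  (forall z w, h (z - w) = h z - h w) -> (forall z, `|h z| <= modulus z) ->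
  continuous (fun x => h (gamma x)).
Proof.
move=> hB hle x; apply/cvgrPdist_lt => e e0.
have e0' : 0 < e%:C%C by rewrite ltcR.
have /cvgrPdist_lt /(_ _ e0') := @character_continuous _ _ gamma x.
apply: filterS => y; rewrite -modulusE ltcR; apply: le_lt_trans.
by rewrite -hB hle.
Qed.

Lemma modulus_character gamma x : modulus (gamma x) = 1.
Proof. by rewrite /modulus character_norm. Qed.

Lemma max0_sub (a : R) : Num.max 0 a - Num.max 0 (- a) = a.
Proof.
have [a0|a0] := leP 0 a; first by rewrite max_l ?oppr_le0// subr0.
by rewrite max_r ?oppr_ge0 ?(ltW a0)// opprK add0r.
Qed.

(** For h the real or imaginary part, up to sign, these are the four positive measures into which a
    complex point measure splits. *)
Definition positive_part_points (h : R[i] -> R) (m : seq (R[i] * G)) :=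
  [seq (Num.max 0 (h w.1), w.2) | w <- m].

Lemma positive_part_points_ge0 h m :
  all (fun w => 0 <= w.1) (positive_part_points h m).
Proof. by apply/allP => _ /mapP[w _ ->] /=; rewrite le_max lexx. Qed.

Lemma positive_part_points_sum h m c : (forall z, `|h z| <= modulus z) ->
  \sum_(w <- m) modulus w.1 <= c ->
  \sum_(w <- positive_part_points h m) w.1 <= c.
Proof.
move=> hle; apply: le_trans; rewrite big_map; apply: ler_sum => w _ /=.
by rewrite ge_max modulus_ge0 (le_trans (ler_norm _)).
Qed.

Lemma point_integral_part h m (f : G -> R) :
  point_integral (positive_part_points h m) f -
  point_integral (positive_part_points (fun z => - h z) m) f =
  \sum_(w <- m) h w.1 * f w.2.
Proof.
rewrite /point_integral !big_map -sumrB; apply: eq_bigr => w _ /=.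
by rewrite -mulrBl max0_sub.
Qed.

Hypothesis compactG : compact [set: G].
Hypothesis hausdorffG : hausdorff_space G.

(** As c is uniform in r and e, the approximating measures have weak limits along an ultrafilter
    that eventually includes each gamma and each precision, so the errors vanish in the limit. *)
Lemma interpolation_of_approximation (E : set (character R G))
    (phi : character R G -> R[i]) (c : R) :
  (forall (r : seq {classic character R G}) (e : R), 0 < e ->
    exists2 m : seq (R[i] * G), \sum_(w <- m) modulus w.1 <= c &
      forall gamma, (gamma : {classic character R G}) \in r -> E gamma ->
        modulus (\sum_(w <- m) w.1 * gamma w.2 - phi gamma) <= e) ->
  exists mu : complex_measure (Borel G) R, regular_measure mu /\
    forall gamma, E gamma -> Fourier_Stieltjes mu gamma = phi gamma.
Proof.
move=> approx; pose I := (seq {classic character R G} * nat)%type.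
have /choice[m mP] (i : I) : exists m : seq (R[i] * G),
    \sum_(w <- m) modulus w.1 <= c /\
    forall gamma, (gamma : {classic character R G}) \in i.1 -> E gamma ->
      modulus (\sum_(w <- m) w.1 * gamma w.2 - phi gamma) <= i.2.+1%:R^-1.
  by have [|m mc mE] := approx i.1 i.2.+1%:R^-1; [rewrite invr_gt0|exists m].
(* Pairs of a finite list and a precision are directed; an ultrafilter refining their tails makes
   all the bounded integrals converge at once. *)
pose above (i : I) := [set j : I | {subset i.1 <= j.1} /\ (i.2 <= j.2)%N].
have F0 : ProperFilter (filter_from [set: I] above).
  apply: filter_from_proper; last by move=> i _; exists i; split.
  apply: filter_from_filter; first by exists (([::], 0%N) : I).
  move=> i j _ _; exists (i.1 ++ j.1, maxn i.2 j.2) => // k [/= ijk1].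
  rewrite geq_max => /andP[ik jk]; split; split => // x xi; apply: ijk1;
    by rewrite mem_cat xi ?orbT.
have [F [FU sF]] := ultraFilterLemma F0.
have limit h : (forall z, `|h z| <= modulus z) ->
    exists nu : {finite_measure set (Borel G) -> \bar R}, outer_regular nu /\
    (forall f : G -> R, continuous f -> (forall x, `|f x| <= 1) ->
      point_integral (positive_part_points h (m i)) f @[i --> F]
        --> Rintegral nu setT f).
  move=> hle; apply: (@weak_limit R G I F _ c) => // i.
    exact: positive_part_points_ge0.
  by apply: positive_part_points_sum => //; have [] := mP i.
have Nle (h : R[i] -> R) : (forall z, `|h z| <= modulus z) ->
    forall z, `|- h z| <= modulus z.
  by move=> hle z; rewrite normrN.
have [p1 [rp1 Lp1]] := limit _ Re_le_modulus.
have [n1 [rn1 Ln1]] := limit _ (Nle _ Re_le_modulus).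
have [p2 [rp2 Lp2]] := limit _ Im_le_modulus.
have [n2 [rn2 Ln2]] := limit _ (Nle _ Im_le_modulus).
exists (ComplexMeasure (charge_difference p1 n1) (charge_difference p2 n2)).
split; first by apply: complex_difference_regular.
move=> gamma Egamma.
pose S i := \sum_(w <- m i) w.1 * gamma w.2.
have S_cvg (h : R[i] -> R) : (forall z w, h (z - w) = h z - h w) ->
    (forall z, `|h z| <= modulus z) -> h (S i) @[i --> F] --> h (phi gamma).
  move=> hB hle; apply/cvgrPdist_le => e e0.
  pose n := Num.bound e^-1.
  have ne : n.+1%:R^-1 <= e.
    rewrite invf_ple ?posrE//; have : e^-1 < n%:R.
      by apply: archi_boundP; rewrite invr_ge0 ltW.
    by move=> /ltW/le_trans; apply; rewrite ler_nat.
  apply: sF; exists ([:: gamma], n) => // i [/= gi ni].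
  rewrite distrC -hB (le_trans (hle _))// (le_trans _ ne)//.
  have [_ /(_ gamma)] := mP i.
  move=> /(_ (gi _ (mem_head _ _)) Egamma)/le_trans; apply.
  by rewrite lef_pV2 ?posrE// ler_nat.
pose u x := complex.Re (gamma x); pose v x := complex.Im (gamma x).
have cu : continuous u.
  by apply: (character_part_continuous (h := @complex.Re R)) => [z w|];
    [exact: ReB|exact: Re_le_modulus].
have cv : continuous v.
  by apply: (character_part_continuous (h := @complex.Im R)) => [z w|];
    [exact: ImB|exact: Im_le_modulus].
have u1 x : `|u x| <= 1 by rewrite -(modulus_character gamma x) Re_le_modulus.
have v1 x : `|v x| <= 1 by rewrite -(modulus_character gamma x) Im_le_modulus.
have mu_ := continuous_borel_measurable cu.
have mv_ := continuous_borel_measurable cv.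
have intE p n f := @charge_integral_difference _ (Borel G) R p n f 1.
transitivity ((Rintegral p1 setT u - Rintegral n1 setT u -
    (Rintegral p2 setT v - Rintegral n2 setT v)) +i*
  (Rintegral p1 setT v - Rintegral n1 setT v +
    (Rintegral p2 setT u - Rintegral n2 setT u)))%C.
  congr (_ +i* _)%C; [congr (_ - _)|congr (_ + _)]; exact: intE.
have SE i : S i = ((\sum_(w <- m i) complex.Re w.1 * u w.2 -
     \sum_(w <- m i) complex.Im w.1 * v w.2) +i*
   (\sum_(w <- m i) complex.Re w.1 * v w.2 +
     \sum_(w <- m i) complex.Im w.1 * u w.2))%C.
  rewrite /S /u /v; elim: (m i) => [|w r IH]; first by rewrite !big_nil subrr addr0.
  rewrite !big_cons IH; case: w => -[a b] x /=; case: (gamma x) => a' b' /=.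
  by simpc; congr (_ +i* _)%C; ring.
have Re_cvg := S_cvg _ ReB Re_le_modulus.
have Im_cvg := S_cvg _ ImB Im_le_modulus.
have ReL : complex.Re (S i) @[i --> F] --> Rintegral p1 setT u - Rintegral n1 setT u -
    (Rintegral p2 setT v - Rintegral n2 setT v).
  under eq_fun do rewrite SE /= -!point_integral_part.
  by apply: cvgB; apply: cvgB; [exact: Lp1|exact: Ln1|exact: Lp2|exact: Ln2].
have ImL : complex.Im (S i) @[i --> F] --> Rintegral p1 setT v - Rintegral n1 setT v +
    (Rintegral p2 setT u - Rintegral n2 setT u).
  under eq_fun do rewrite SE /= -!point_integral_part.
  by apply: cvgD; apply: cvgB; [exact: Lp1|exact: Ln1|exact: Lp2|exact: Ln2].
rewrite (cvg_unique _ ReL Re_cvg) ?(cvg_unique _ ImL Im_cvg)//.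
by case: (phi gamma).
Qed.

End Sidon.

Lemma Kronecker_Sidon (R : realType) (G : topologicalZmodType)
    (E : set (character R G)) (eps : R) :
  compact [set: G] -> hausdorff_space G -> 0 < eps < 2 -> Kronecker E eps ->
  Sidon E.
Proof.
move=> compactG hausdorffG /andP[eps0 eps2] kron phi [M phiM].
have epsC : 0 <= eps%:C%C < (2%:R : R[i]).
  by rewrite ler0c (ltW eps0)/= -(rmorph_nat (real_complex R)) ltcR.
have [K KP] := finite_interpolation (@complex_expr_small R) epsC.
(* Adding 1 keeps B positive even for [M = 0]; [phi / B] is bounded by 1 on E. *)
pose B := `|M| + 1; have B0 : 0 < B by rewrite ltr_wpDl.
have phiB gamma : E gamma -> `|phi gamma / B%:C%C| <= 1.
  move=> Eg; have B0' : 0 < B%:C%C by rewrite ltcR.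
  rewrite normrM normfV (gtr0_norm B0') ler_pdivrMr// mul1r.
  by rewrite (le_trans (phiM _ Eg))// lecR (le_trans (ler_norm M))// lerDl.
apply: (@interpolation_of_approximation R G compactG hausdorffG E phi
  (B * complex.Re K)) => r e e0.
pose r' : seq {classic character R G} := [seq gamma <- r | asbool (E (gamma : character R G))].
have Er' (t : seq_sub r') : E (val t).
  by have := valP t; rewrite mem_filter => /andP[/asboolP].
pose g (t : seq_sub r') (x : G) : R[i] := (val t : character R G) x.
have [n ne] : exists n, (7%:R / 8%:R : R[i]) ^+ n <= (e / B)%:C%C.
  apply: complex_expr_small; last by rewrite ltcR divr_gt0.
  by rewrite divr_ge0//= ltr_pdivrMr ?ltr0n// mul1r ltr_nat.
have g_inj s t : s != t -> exists x, g s x != g t x.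
  apply: contraNP => h; apply/eqP/val_inj/character_ext => x.
  by apply/eqP; apply: contra_notT h => ?; exists x.
have kron_fin (theta : seq_sub r' -> R[i]) : (forall t, `|theta t| = 1) ->
    exists x, forall t, `|theta t - g t x| <= eps%:C%C.
  move=> theta1.
  (* The target is extended by 1 outside [r'], since [Kronecker] asks for unimodular values on all
     of E. *)
  have [gamma _|x xP] := kron (fun gamma =>
    oapp theta 1 (insub (gamma : {classic character R G}))).
    by case: insub => [t|] /=; rewrite ?theta1 ?normr1.
  by exists x => t; have := xP _ (Er' t); rewrite valK => /ltW.
have [||v [m mK mv] vP] := KP G (seq_sub r') g _ _ g_inj kron_fin n
    (fun t => phi (val t) / B%:C%C) (fun t => phiB _ (Er' t)).
- by move=> t x y; exact: characterD.
- by move=> t x; exact: character_norm.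
have K0 : 0 <= K by apply: le_trans mK; apply: sumr_ge0.
have BC0 : B%:C%C != 0 :> R[i] by rewrite gt_eqF// ltcR.
exists [seq (B%:C%C * w.1, w.2) | w <- m].
  rewrite big_map -lecR rmorph_sum rmorphM /= RRe_real ?ger0_real//.
  under eq_bigr do rewrite modulusE normrM ger0_norm ?ler0c ?(ltW B0)//.
  by rewrite -mulr_sumr ler_wpM2l// ler0c ltW.
move=> gamma gr Eg; have gr' : (gamma : {classic character R G}) \in r'.
  by rewrite mem_filter gr andbT; apply/asboolP.
have := vP (SeqSub gr'); rewrite mv /g/= => h.
rewrite -lecR modulusE big_map.
rewrite (_ : _ - _ = B%:C%C * (\sum_(w <- m) w.1 * gamma w.2 - phi gamma / B%:C%C)).
  rewrite normrM ger0_norm ?ler0c ?(ltW B0)//.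
  rewrite -ler_pdivlMl ?ltcR// (le_trans h)// (le_trans ne)//.
  by rewrite rmorphM fmorphV mulrC.
rewrite mulrBr mulr_sumr mulrCA divff// mulr1; congr (_ - _).
by apply: eq_bigr => w _; rewrite mulrA.
Qed.

Theorem theorem2 (R : realType) (G : topologicalZmodType)
  (compactG : compact [set: G]) (hausdorffG : hausdorff_space G)
  (E : set (character R G)) :
  Kronecker_constant E < 2 -> Sidon E.
Proof.
move=> /inf_lt[|eps [eps0 kron] eps2].
  (* The infimum is over a nonempty set: points of the unit circle are at distance at most 2, so 3
     belongs to it. *)
  exists 3; split => // phi phi1; exists 0 => gamma Eg.
  rewrite (le_lt_trans (ler_normB _ _))// phi1// character_norm.
  by rewrite -[1 + 1]/(2%:R) -(rmorph_nat (real_complex R)) ltcR ltr_nat.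
by apply: (Kronecker_Sidon compactG hausdorffG _ kron); rewrite eps0.
Qed.
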